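(* Let $U,V,W\subset\mathbb{C}$ be non-empty and compact, let $p\in[1,\infty]$, and let $A_+\in\Psi E_+(U,V,W)$ be invertible on $\ell^p(\mathbb{N})$. Let $u\in U$, $v\in V$, $w\in W$ be arbitrary. (1) There exists a monotonically increasing sequence $(r_n)_{n\in\mathbb{N}}$ of positive integers with $r_n\to+\infty$ such that for all $n\in\mathbb{N}$ $$|u_i-u|+|v_i-v|+|w_i-w|<\tfrac1n\qquad\text{for all } i\in\{r_n-n,\dots,r_n-1,r_n\}.$$ (2) One has $V\subseteq E_-(U,W)$. (3) For any sequence $(r_n)$ as in (1), the finite section method with cut-offs at $l_n=1$ (for all $n$) and $(r_n)$ is applicable to the equation $A_+x=b$ (for every right-hand side $b\in\ell^p(\mathbb{N})$).
   Context: $\mathbb{N}=\{1,2,3,\dots\}$. Matrices. $M(U,V,W)$ is the set of all bi-infinite tridiagonal matrices $A=(a_{ij})_{i,j\in\mathbb{Z}}$ with $a_{i,i-1}=u_i\in U$, $a_{ii}=v_i\in V$, $a_{i,i+1}=w_i\in W$ for all $i\in\mathbb{Z}$ and all other entries zero. $\Psi E_+(U,V,W)$ is the set of all semi-infinite submatrices $A_+=(a_{ij})_{i,j\in\mathbb{N}}$ of those $A\in M(U,V,W)$ that are right-pseudoergodic, i.e. for which the sequence $(a_i)_{i\in\mathbb{N}}$ with $a_i:=(u_i,v_i,w_i)\in\mathcal{M}:=U\times V\times W\subset\mathbb{C}^3$ is pseudoergodic: for every $\varepsilon>0$, every $n\in\mathbb{N}$ and every $(b_1,\dots,b_n)\in\mathcal{M}^n$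 there is $k\in\mathbb{N}$ with $|a_{k+i}-b_i|<\varepsilon$ for $i=1,\dots,n$. $A_+$ acts as a bounded operator on $\ell^p(\mathbb{N})$ by matrix-vector multiplication; $u_i,v_i,w_i$ denote the entries of (the bi-infinite matrix $A$ underlying) $A_+$. Ellipses. For $u,w\in\mathbb{C}$, $E(u,w):=\{v\in\mathbb{C}:|v+2\sqrt{uw}|+|v-2\sqrt{uw}|=2(|u|+|w|)\}$ (a possibly degenerate ellipse), $E_-(u,w)$ is its exterior (the unbounded component of $\mathbb{C}\setminus E(u,w)$), i.e. $E_-(u,w)=\{v:|v+2\sqrt{uw}|+|v-2\sqrt{uw}|>2(|u|+|w|)\}$, and $E_-(U,W):=\bigcap_{u\in U,\,w\in W}E_-(u,w)$. Finite section method (FSM). Let $X=\ell^p(\mathbb{N})$. For a positive integer $r$ let $P_{1,r}:X\to X$ be the operator of multiplication by the characteristic function of $\{1,\dots,r\}$, with image $X_{1,r}\cong\mathbb{C}^r$. Given positive integers $r_n\to+\infty$, the FSM with cut-offs at $l_n=1$ and $(r_n)$ is applicable to $A_+x=b$ (for every right-hand side) if for every $b\in X$ the finite systems $P_{1,r_n}A_+P_{1,r_n}x_n=P_{1,r_n}b$ have a unique solution $x_n\in X_{1,r_n}$ for all sufficiently large $n$, and these solutions remain bounded in $n$ and converge componentwise to the solution $x$ of $A_+x=b$. *)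

(* Defs.v *)
From mathcomp Require Import all_boot all_order all_algebra.
From mathcomp Require Import all_classical all_reals all_analysis.
From mathcomp Require Import complex.

Set Implicit Arguments.
Unset Strict Implicit.
Unset Printing Implicit Defensive.

Import Order.TTheory GRing.Theory Num.Theory.
Import numFieldNormedType.Exports.

Local Open Scope classical_set_scope.
Local Open Scope ring_scope.
Local Open Scope complex_scope.

(* The complex numbers are R[i] with R a realType. Their modulus `|z| is an
   element of R[i]; inequalities between moduli are read in the partial order
   of R[i], which extends the order of the real axis. The usual topology of
   the complex plane is carried by the alias R[i]^o. *)

(** Bi-infinite and semi-infinite matrices *)

Definition tridiag (R : realType) (U V W : set R[i]^o) :
    set (int -> int -> R[i]) :=
  [set A | (forall i, [/\ U (A i (i - 1)), V (A i i) & W (A i (i + 1))]) /\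
           (forall i j, 1 < `|i - j| -> A i j = 0)].

Definition band (R : realType) (A : int -> int -> R[i]) (i : int) :
  R[i] * R[i] * R[i] := (A i (i - 1), A i i, A i (i + 1)).

Definition dist3 (R : realType) (a b : R[i] * R[i] * R[i]) : R[i] :=
  sqrtC (`|a.1.1 - b.1.1| ^+ 2 + `|a.1.2 - b.1.2| ^+ 2 + `|a.2 - b.2| ^+ 2).

(* Positions are numbered from 1: the values at 0 of a and b are irrelevant. *)
Definition pseudoergodic (R : realType) (M : set (R[i] * R[i] * R[i]))
    (a : nat -> R[i] * R[i] * R[i]) : Prop :=
  forall (e : R) (n : nat) (b : nat -> R[i] * R[i] * R[i]),
    0 < e -> (0 < n)%N -> (forall i, (1 <= i <= n)%N -> M (b i)) ->
    exists2 k : nat, (0 < k)%N &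
      forall i, (1 <= i <= n)%N -> dist3 (a (k + i)%N) (b i) < e%:C.

Definition right_pseudoergodic (R : realType) (U V W : set R[i]^o)
    (A : int -> int -> R[i]) : Prop :=
  pseudoergodic (U `*` V `*` W) (fun i : nat => band A i%:Z).

(* Sequences indexed by {1, 2, ...} are stored as functions on nat, the index
   k : nat standing for position k + 1; likewise for semi-infinite matrices. *)
Definition semi (R : realType) (A : int -> int -> R[i]) : nat -> nat -> R[i] :=
  fun k l => A k.+1%:Z l.+1%:Z.

(** Ellipses *)

Definition ellipse_ext (R : realType) (u w : R[i]) : set R[i]^o :=
  [set v | `|v + 2 * sqrtC (u * w)| + `|v - 2 * sqrtC (u * w)| >
           2 * (`|u| + `|w|)].

Definition ellipses_ext (R : realType) (U W : set R[i]^o) : set R[i]^o :=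
  \bigcap_(u in U) \bigcap_(w in W) ellipse_ext u w.

(** The spaces l^p and their operators *)

Definition lpnorm (R : realType) (p : \bar R) (x : nat -> R[i]) : \bar R :=
  Lnorm (@counting nat R) p (fun k => (complex.Re `|x k|)%:E).

Definition lp (R : realType) (p : \bar R) : set (nat -> R[i]) :=
  [set x | (lpnorm p x < +oo)%E].

(* Only meant for tridiagonal B: row k vanishes beyond column k + 1, so that
   this finite sum is the whole k-th coordinate of the product. *)
Definition mulmv (R : realType) (B : nat -> nat -> R[i]) (x : nat -> R[i]) :
    nat -> R[i] :=
  fun k => \sum_(0 <= l < k.+2) B k l * x l.

Definition bounded_operator (R : realType) (p : \bar R)
    (T : (nat -> R[i]) -> (nat -> R[i])) : Prop :=
  [/\ forall x, lp p x -> lp p (T x),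
      forall (c : R[i]) x y, lp p x -> lp p y ->
        T (fun k => c * x k + y k) = (fun k => c * T x k + T y k) &
      exists M : R, forall x, lp p x -> (lpnorm p (T x) <= M%:E * lpnorm p x)%E].

Definition invertible_on (R : realType) (p : \bar R)
    (T : (nat -> R[i]) -> (nat -> R[i])) : Prop :=
  exists S, bounded_operator p S /\
    forall x, lp p x -> T (S x) = x /\ S (T x) = x.

(** The finite section method *)

Definition truncate (R : realType) (r : nat) (x : nat -> R[i]) : nat -> R[i] :=
  fun k => if (k < r)%N then x k else 0.

Definition section_space (R : realType) (p : \bar R) (r : nat) :
    set (nat -> R[i]) :=
  [set truncate r x | x in lp p].

Definition section_solution (R : realType) (p : \bar R)
    (B : nat -> nat -> R[i]) (r : nat) (b x : nat -> R[i]) : Prop :=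
  section_space p r x /\ truncate r (mulmv B (truncate r x)) = truncate r b.

Definition fsm_applicable (R : realType) (p : \bar R)
    (B : nat -> nat -> R[i]) (r : nat -> nat) : Prop :=
  forall b, lp p b ->
    exists2 x, unique (fun y => lp p y /\ mulmv B y = b) x &
    exists (N : nat) (xs : nat -> nat -> R[i]),
      [/\ forall n, (N <= n)%N ->
            unique (section_solution p B (r n) b) (xs n),
          exists M : R, forall n, (N <= n)%N -> (lpnorm p (xs n) <= M%:E)%E &
          forall k, (fun n => xs n k : R[i]^o) @ \oo --> (x k : R[i]^o)].

(* Sequences (r_n) with n = 1, 2, ...: the value r 0 is irrelevant. The window
   {r_n - n, ..., r_n} may contain nonpositive indices. *)
Definition good_cutoffs (R : realType) (A : int -> int -> R[i]) (u v w : R[i])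
    (r : nat -> nat) : Prop :=
  [/\ forall n, (1 <= n)%N -> (0 < r n)%N,
      forall m n, (1 <= m)%N -> (m <= n)%N -> (r m <= r n)%N,
      r @ \oo --> \oo &
      forall n (i : int), (1 <= n)%N -> (r n)%:Z - n%:Z <= i <= (r n)%:Z ->
        `|A i (i - 1) - u| + `|A i i - v| + `|A i (i + 1) - w| < n%:R^-1].

(* Main.v *)
Require Import Defs.
From mathcomp Require Import all_boot all_order all_algebra.
From mathcomp Require Import all_classical all_reals all_analysis.
From mathcomp Require Import complex.
From mathcomp Require Import ess_sup_inf.
From mathcomp Require Import ring lra zify.
Set Implicit Arguments.
Unset Strict Implicit.
Unset Printing Implicit Defensive.
Import Order.TTheory GRing.Theory Num.Theory.
Import numFieldNormedType.Exports.
Local Open Scope classical_set_scope.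
Local Open Scope ring_scope.

(** Everything rests on the lower bound |x| <= M |Ax| and on slowly varying
    cutoffs phi, for which A phi - phi A has norm O(Lip phi) on every l^p.

    For (u, v, w) in U x V x W write w L^2 + v L + u = (al + be L) (ga L + de).
    A unimodular zero t would make phi_k t^k, phi supported in a window where
    the band is close to (u, v, w), violate the lower bound.  If both zeros
    were inside the unit disc, the nonzero vectors on {1, ..., m} killed by
    the rows above m would decay along a window ending at m, so that their
    image would be too small; zeros outside the disc are the same situation
    for the transposed matrix.  Hence, up to exchanging the factors,
    |be| < |al| and |de| < |ga|.  This is the ellipse condition, because
    |v + 2 sqrt(uw)| + |v - 2 sqrt(uw)| = 2 (|al ga| + |be de|), and it also
    bounds the Toeplitz operator on a left half-line from below, the two
    factors acting there by triangular contraction estimates.  Gluing this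
    bound near the cut-off with the one of A elsewhere gives the stability of
    the finite sections; a last cutoff gives componentwise convergence. *)

(** * The modulus as a real number *)

Section Modulus.
Context {R : realType}.
Implicit Types y z : R[i].

(** A copy of the modulus in [R], where the order is total and linear arithmetic applies. *)
Definition md z : R := complex.Re `|z|.

Lemma normE z : `|z| = (md z)%:C%C.
Proof. by rewrite /md; case: z => a b; rewrite normc_def. Qed.

Lemma md_ge0 z : 0 <= md z.
Proof. by rewrite -lecR -normE; exact: normr_ge0. Qed.

Lemma md0 : md 0 = 0.
Proof. by rewrite /md normr0. Qed.

Lemma md1 : md 1 = 1.
Proof. by rewrite /md normr1. Qed.

Lemma md_eq0 z : (md z == 0) = (z == 0).
Proof. by rewrite -[z == 0]normr_eq0 normE -(inj_eq (@complexI R)). Qed.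

Lemma md_gt0 z : (0 < md z) = (z != 0).
Proof. by rewrite lt_def md_ge0 andbT md_eq0. Qed.

Lemma mdM y z : md (y * z) = md y * md z.
Proof. by apply: (@complexI R); rewrite -normE normrM !normE rmorphM. Qed.

Lemma mdD y z : md (y + z) <= md y + md z.
Proof. by rewrite -lecR rmorphD -!normE ler_normD. Qed.

Lemma mdN z : md (- z) = md z.
Proof. by rewrite /md normrN. Qed.

Lemma mdB y z : md (y - z) <= md y + md z.
Proof. by rewrite -(mdN z) mdD. Qed.

Lemma mdBC y z : md (y - z) = md (z - y).
Proof. by rewrite -mdN opprB. Qed.

Lemma mdX z n : md (z ^+ n) = md z ^+ n.
Proof. by elim: n => [|n ih]; rewrite ?expr0 ?md1// !exprS mdM ih. Qed.

Lemma mdV z : md z^-1 = (md z)^-1.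
Proof. by apply: (@complexI R); rewrite -normE normfV normE fmorphV. Qed.

Lemma md_real (a : R) : md a%:C%C = `|a|.
Proof. by rewrite /md normc_def/= expr0n/= addr0 sqrtr_sqr. Qed.

End Modulus.

(** * The l^p norm *)

Section LpNorm.
Context {R : realType} {p : \bar R} (p1 : (1%:E <= p)%E).
Implicit Types x y : nat -> R[i].

Definition sh x : nat -> R[i] := fun k => if k is j.+1 then x j else 0.
Definition lsh x : nat -> R[i] := fun k => x k.+1.

Lemma counting_eq0 (B : set nat) : @counting nat R B = 0%E -> B = set0.
Proof.
rewrite /counting; case: ifPn => [/asboolP fB /eqP|//].
rewrite eqe pnatr_eq0 finmap.cardfs_eq0 => /eqP B0.
by rewrite -(fset_setK fB) B0 set_fset0.
Qed.

Lemma counting_setT_gt0 : (0 < @counting nat R [set: nat])%E.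
Proof.
by rewrite /counting; case: asboolP => // fT; have := infinite_nat.
Qed.

(** Only the empty set is null for the counting measure, so the case p = oo is a plain supremum. *)
Lemma ess_sup_counting (f : nat -> \bar R) (c : \bar R) :
  (ess_sup (@counting nat R) f <= c)%E <-> forall k, (f k <= c)%E.
Proof.
split=> [/ess_supP [B [_ B0 fB]] k|fc]; last by apply/ess_supP/nearW.
rewrite leNgt; apply/negP => ck.
have : B k by have := fB k; rewrite /setC /= leNgt ck => h; exact: h.
by rewrite (counting_eq0 B0).
Qed.

Lemma lpnormy x c : (lpnorm +oo x <= c)%E <-> forall k, ((md (x k))%:E <= c)%E.
Proof.
rewrite /lpnorm unlock ifT; last exact: counting_setT_gt0.
apply: iff_trans (ess_sup_counting _ _) _.
by split=> h k; have := h k; rewrite /= ger0_norm// md_ge0.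
Qed.

Lemma lpnorm_fin (r : R) x : 1 <= r ->
  lpnorm r%:E x = ((\sum_(k <oo) ((md (x k)) `^ r)%:E) `^ r^-1)%E.
Proof.
move=> r1; rewrite /lpnorm Lnorm_counting ?(lt_le_trans _ r1)//.
congr (_ `^ _)%E; apply: eq_eseriesr => k _ /=.
by rewrite ger0_norm// md_ge0.
Qed.

Lemma sum_powR_itv (f : nat -> R) (r : R) :
  (\sum_(k <oo) ((f k) `^ r)%:E)%E \in `[0%E, +oo%E].
Proof.
by rewrite in_itv/= leey andbT nneseries_ge0// => k _ _; rewrite lee_fin powR_ge0.
Qed.

Lemma lpnorm_ge0 x : (0 <= lpnorm p x)%E.
Proof. exact: Lnorm_ge0. Qed.

Lemma le_lpnorm x y : (forall k, md (x k) <= md (y k)) ->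
  (lpnorm p x <= lpnorm p y)%E.
Proof.
case: p p1 => [r|_|]//; last first.
  move=> xy; apply/lpnormy => k; apply: le_trans (_ : (md (y k))%:E <= _)%E.
    by rewrite lee_fin.
  by move: k; apply/lpnormy.
rewrite lee_fin => r1 xy; have r0 : 0 < r by exact: lt_le_trans r1.
rewrite !lpnorm_fin// gt0_ler_poweR ?sum_powR_itv ?invr_ge0 ?(ltW r0)//.
apply: lee_nneseries => k _; first by move=> _; rewrite lee_fin powR_ge0.
by rewrite lee_fin ge0_ler_powR ?(ltW r0)// nnegrE md_ge0.
Qed.


Lemma lpnormD x y : (lpnorm p (fun k => x k + y k)%R <= lpnorm p x + lpnorm p y)%E.
Proof.
have -> : lpnorm p x = Lnorm counting p (EFin \o (md \o x)) by [].
have -> : lpnorm p y = Lnorm counting p (EFin \o (md \o y)) by [].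
apply: le_trans (@eminkowski _ nat R counting (md \o x) (md \o y) p _ _ p1) => //.
set z := (fun k => (md (x k) + md (y k))%:C%C : R[i]).
suff -> : Lnorm counting p (EFin \o ((md \o x) \+ (md \o y))%R) = lpnorm p z.
  apply: le_lpnorm => k; rewrite md_real ger0_norm ?mdD//.
  by rewrite addr_ge0 ?md_ge0.
apply: eq_Lnorm => k; congr EFin.
rewrite -[RHS]/(md (z k)) md_real ger0_norm//.
by rewrite addr_ge0 ?md_ge0.
Qed.

Lemma lpnormZ (c : R[i]) x : (lpnorm p (fun k => c * x k)%R <= (md c)%:E * lpnorm p x)%E.
Proof.
case: p p1 => [r|_|]//; last first.
  apply/lpnormy => k; rewrite mdM EFinM lee_wpmul2l ?lee_fin ?md_ge0//.
  by move: k; apply/lpnormy.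
rewrite lee_fin => r1; have r0 : 0 < r by exact: lt_le_trans r1.
rewrite !lpnorm_fin//.
under eq_eseriesr do rewrite mdM powRM ?md_ge0// EFinM.
rewrite nneseriesZl; last by move=> k _; rewrite lee_fin powR_ge0.
rewrite poweRM ?lee_fin ?powR_ge0//; last first.
  by rewrite nneseries_ge0// => k _ _; rewrite lee_fin powR_ge0.
by rewrite -poweR_EFin -poweRrM mulfV ?gt_eqF// poweRe1 ?lee_fin ?md_ge0.
Qed.

Lemma lpnorm_sh x : (lpnorm p (sh x) <= lpnorm p x)%E.
Proof.
case: p p1 => [r|_|]//; last first.
  apply/lpnormy => -[|k] /=; first by rewrite md0; exact: Lnorm_ge0.
  by move: k; apply/lpnormy.
rewrite lee_fin => r1; have r0 : 0 < r by exact: lt_le_trans r1.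
rewrite !lpnorm_fin// gt0_ler_poweR ?sum_powR_itv ?invr_ge0 ?(ltW r0)//.
rewrite (nneseries_split 0 1); last by move=> k _; rewrite lee_fin powR_ge0.
rewrite big_nat1 /= md0 powR0 ?gt_eqF// add0e add0n -nneseries_addn; last first.
  by move=> i; rewrite lee_fin powR_ge0.
by under eq_eseriesr do rewrite addn1 /=.
Qed.

Lemma lpnorm_lsh x : (lpnorm p (lsh x) <= lpnorm p x)%E.
Proof.
case: p p1 => [r|_|]//; last first.
  apply/lpnormy => k /=; rewrite /lsh.
  by move: (k.+1); apply/lpnormy.
rewrite lee_fin => r1; have r0 : 0 < r by exact: lt_le_trans r1.
rewrite !lpnorm_fin// gt0_ler_poweR ?sum_powR_itv ?invr_ge0 ?(ltW r0)//.
rewrite [leRHS](nneseries_split 0 1); last by move=> k _; rewrite lee_fin powR_ge0.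
rewrite big_nat1 add0n -nneseries_addn; last by move=> i; rewrite lee_fin powR_ge0.
under [X in (_ <= _ + X)%E]eq_eseriesr do rewrite addn1.
by rewrite leeDr// lee_fin powR_ge0.
Qed.

Lemma le_coord_lpnorm x k : ((md (x k))%:E <= lpnorm p x)%E.
Proof.
case: p p1 => [r|_|]//; last by move: k; apply/lpnormy.
rewrite lee_fin => r1; have r0 : 0 < r by exact: lt_le_trans r1.
rewrite !lpnorm_fin//.
have -> : (md (x k))%:E = ((((md (x k)) `^ r)%:E) `^ r^-1)%E.
  by rewrite -poweR_EFin -poweRrM mulfV ?gt_eqF// poweRe1 ?lee_fin ?md_ge0.
rewrite gt0_ler_poweR ?sum_powR_itv ?invr_ge0 ?(ltW r0)//.
  by rewrite in_itv/= leey andbT lee_fin powR_ge0.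
rewrite (@nneseriesD1 _ _ k)//; last by move=> i _; rewrite lee_fin powR_ge0.
by rewrite leeDl// nneseries_ge0// => i _ _; rewrite lee_fin powR_ge0.
Qed.

Lemma lpnorm_e0 : (lpnorm p (fun k => (k == 0%N)%:R) <= 1)%E.
Proof.
case: p p1 => [r|_|]//; last first.
  by apply/lpnormy => -[|k] /=; rewrite ?md1 ?md0 lee_fin.
rewrite lee_fin => r1; have r0 : 0 < r by exact: lt_le_trans r1.
rewrite !lpnorm_fin// (@nneseriesD1 _ _ 0)//; last first.
  by move=> i _; rewrite lee_fin powR_ge0.
rewrite eseries0 ?adde0 => [|[|i]] //=; last by rewrite md0 powR0 ?gt_eqF.
by rewrite md1 !powR1.
Qed.

End LpNorm.

(** * Membership in l^p and real-valued norms *)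

Section Nrm.
Context {R : realType} {p : \bar R} (p1 : (1%:E <= p)%E).
Implicit Types (x y : nat -> R[i]) (phi : nat -> R).

(** [fine] sends +oo to 0, so an upper bound on [nrm] is informative only along with membership in
    [lp]; many lemmas below deliver the two together. *)
Definition nrm (p : \bar R) x : R := fine (lpnorm p x).

Lemma nrmE x : lp p x -> lpnorm p x = (nrm p x)%:E.
Proof. by move=> lx; rewrite fineK// ge0_fin_numE ?lpnorm_ge0. Qed.

Lemma nrm_ge0 x : 0 <= nrm p x.
Proof. exact/fine_ge0/lpnorm_ge0. Qed.

Lemma lp_bound x (M : R) : (lpnorm p x <= M%:E)%E -> lp p x /\ nrm p x <= M.
Proof.
move=> xM; have lx : lp p x by rewrite /lp/=; exact: le_lt_trans xM (ltry _).
by split=> //; rewrite -lee_fin -nrmE.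
Qed.

Lemma lp_le x y : (forall k, md (x k) <= md (y k)) -> lp p y ->
  lp p x /\ nrm p x <= nrm p y.
Proof. by move=> xy ly; apply: lp_bound; rewrite -nrmE// le_lpnorm. Qed.

Lemma lp_add x y : lp p x -> lp p y ->
  lp p (fun k => x k + y k) /\ nrm p (fun k => x k + y k) <= nrm p x + nrm p y.
Proof.
by move=> lx ly; apply: lp_bound; rewrite EFinD -!nrmE//; exact: lpnormD.
Qed.

Lemma lp_scale (c : R[i]) x : lp p x ->
  lp p (fun k => c * x k) /\ nrm p (fun k => c * x k) <= md c * nrm p x.
Proof.
by move=> lx; apply: lp_bound; rewrite EFinM -!nrmE//; exact: lpnormZ.
Qed.

Lemma lp_sh x : lp p x -> lp p (sh x) /\ nrm p (sh x) <= nrm p x.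
Proof. by move=> lx; apply: lp_bound; rewrite -nrmE//; exact: lpnorm_sh. Qed.

Lemma lp_lsh x : lp p x -> lp p (lsh x) /\ nrm p (lsh x) <= nrm p x.
Proof. by move=> lx; apply: lp_bound; rewrite -nrmE//; exact: lpnorm_lsh. Qed.

Lemma le_coord_nrm x k : lp p x -> md (x k) <= nrm p x.
Proof. by move=> lx; rewrite -lee_fin -nrmE//; exact: le_coord_lpnorm. Qed.

Lemma lp_le_scale (c : R) x y : 0 <= c -> (forall k, md (x k) <= c * md (y k)) ->
  lp p y -> lp p x /\ nrm p x <= c * nrm p y.
Proof.
move=> c0 xy ly; have [lcy ncy] := lp_scale c%:C%C ly.
have [|lx nx] := @lp_le x (fun k => c%:C%C * y k) _ lcy.
  by move=> k; rewrite mdM md_real ger0_norm.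
by split=> //; apply: le_trans nx _; rewrite md_real ger0_norm in ncy.
Qed.

(** Minkowski's inequality and the contractivity of both shifts. The norm bounds for tridiagonal
    operators reduce to this coordinatewise domination, uniformly in p. *)
Lemma lp_le3 (a b c : R) x y : 0 <= a -> 0 <= b -> 0 <= c ->
  (forall k, md (x k) <= a * md (sh y k) + b * md (y k) + c * md (lsh y k)) ->
  lp p y -> lp p x /\ nrm p x <= (a + b + c) * nrm p y.
Proof.
move=> a0 b0 c0 xy ly.
pose M (d : R) z := fun k : nat => (d * md (z k))%:C%C : R[i].
have lM d z : 0 <= d -> lp p z -> lp p (M d z) /\ nrm p (M d z) <= d * nrm p z.
  move=> d0; apply: lp_le_scale => // k.
  by rewrite md_real ger0_norm// mulr_ge0 ?md_ge0.
have [ls ns] := lp_sh ly; have [ll nl] := lp_lsh ly.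
have [l1 n1] := lM _ _ a0 ls; have [l2 n2] := lM _ _ b0 ly.
have [l3 n3] := lM _ _ c0 ll.
have [l12 n12] := lp_add l1 l2; have [l123 n123] := lp_add l12 l3.
have [|lx nx] := @lp_le x _ _ l123.
  move=> k; rewrite -!rmorphD/= md_real ger0_norm ?xy//.
  by rewrite !addr_ge0 ?mulr_ge0 ?md_ge0.
split=> //; rewrite !mulrDl.
apply: le_trans nx _; apply: le_trans n123 _; rewrite lerD//.
  apply: le_trans n12 _; rewrite lerD//.
  by apply: le_trans n1 _; rewrite ler_wpM2l.
by apply: le_trans n3 _; rewrite ler_wpM2l.
Qed.

Definition unit_seq (j : nat) : nat -> R[i] := fun k => (k == j)%:R.

Lemma lp_unit j : lp p (unit_seq j) /\ nrm p (unit_seq j) <= 1.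
Proof.
elim: j => [|j [lj nj]]; first by apply: lp_bound; exact: lpnorm_e0.
have -> : unit_seq j.+1 = sh (unit_seq j) by apply/funext => -[|k].
by have [ls ns] := lp_sh lj; split=> //; exact: le_trans ns nj.
Qed.

Lemma lp_zero : lp p (fun=> 0) /\ nrm p (fun=> 0) <= 0.
Proof.
have [l0 _] := lp_unit 0; rewrite -[leRHS](mul0r (nrm p (unit_seq 0))).
by apply: lp_le_scale => // k; rewrite md0 mul0r.
Qed.

Lemma lp_finite m x : (forall k, (m <= k)%N -> x k = 0) ->
  lp p x /\ nrm p x <= \sum_(k < m) md (x k).
Proof.
elim: m x => [|m ih] x x0.
  by rewrite big_ord0 (_ : x = fun=> 0); [exact: lp_zero|apply/funext => k; exact: x0].
pose y k := if k == m then 0 else x k.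
have [|ly ny] := ih y.
  move=> k mk; rewrite /y; case: eqP => // /eqP km.
  by rewrite x0// ltn_neqAle eq_sym km mk.
have [lu nu] := lp_unit m; have [lc nc] := lp_scale (x m) lu.
have [lz nz] := lp_add ly lc.
have -> : x = fun k => y k + x m * unit_seq m k.
  apply/funext => k; rewrite /y /unit_seq; case: eqP => [->|_].
    by rewrite mulr1 add0r.
  by rewrite mulr0 addr0.
split=> //; apply: le_trans nz _; rewrite big_ord_recr/= lerD//.
  apply: le_trans ny _; apply: ler_sum => i _.
  by rewrite /y /unit_seq (ltn_eqF (ltn_ord i)) mulr0 addr0.
apply: le_trans nc _; rewrite /y /unit_seq eqxx mulr1 add0r.
by rewrite -[leRHS]mulr1 ler_wpM2l ?md_ge0.
Qed.

End Nrm.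

(** * Tridiagonal operators and cutoffs *)

Section Tridiagonal.
Context {R : realType} {p : \bar R} (p1 : (1%:E <= p)%E).
Implicit Types (a b c x y : nat -> R[i]) (phi : nat -> R).

Definition tri a b c x : nat -> R[i] :=
  fun k => a k * sh x k + b k * x k + c k * x k.+1.

Definition bounded_by (K : R) a := forall k, md (a k) <= K.

Definition cutoff phi x : nat -> R[i] := fun k => (phi k)%:C%C * x k.

Lemma mulmv_tri (A : int -> int -> R[i]) x :
  (forall i j, 1 < `|i - j| -> A i j = 0) ->
  mulmv (semi A) x = tri (fun k => A k.+1%:Z k%:Z) (fun k => A k.+1%:Z k.+1%:Z)
    (fun k => A k.+1%:Z k.+2%:Z) x.
Proof.
move=> A0; apply/funext => k; rewrite /mulmv /tri /semi.
rewrite !big_nat_recr//=; congr (_ + _ + _).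
case: k => [|k]; first by rewrite big_geq//= mulr0.
rewrite big_nat_recr//= big_nat_cond big1 ?add0r// => l.
by rewrite andbT => /= lk; rewrite A0 ?mul0r//; lia.
Qed.

Lemma lp_tri (K : R) a b c x :
  bounded_by K a -> bounded_by K b -> bounded_by K c -> lp p x ->
  lp p (tri a b c x) /\ nrm p (tri a b c x) <= 3 * K * nrm p x.
Proof.
move=> aK bK cK lx; have K0 : 0 <= K by exact: le_trans (md_ge0 _) (aK 0%N).
have -> : 3 * K = K + K + K by ring.
apply: (lp_le3 p1) => // k; rewrite /tri.
apply: le_trans (mdD _ _) _; rewrite mdM lerD ?ler_wpM2r ?md_ge0//.
by apply: le_trans (mdD _ _) _; rewrite !mdM lerD ?ler_wpM2r ?md_ge0.
Qed.

Lemma lp_cutoff phi x : (forall k, 0 <= phi k <= 1) -> lp p x ->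
  lp p (cutoff phi x) /\ nrm p (cutoff phi x) <= nrm p x.
Proof.
move=> phi01; apply: (lp_le p1) => k; rewrite mdM md_real.
have /andP[p0 p1'] := phi01 k.
by rewrite ger0_norm// ler_piMl ?md_ge0.
Qed.

(** The commutator with multiplication by [phi] has only the entries a_k (phi_{k-1} - phi_k) and c_k
    (phi_{k+1} - phi_k), of size at most K eta. *)
Lemma tri_cutoff (K eta : R) a b c phi x :
  bounded_by K a -> bounded_by K b -> bounded_by K c ->
  (forall k, 0 <= phi k <= 1) -> (forall k, `|phi k.+1 - phi k| <= eta) ->
  lp p x ->
  nrm p (tri a b c (cutoff phi x)) <=
  nrm p (cutoff phi (tri a b c x)) + 2 * K * eta * nrm p x.
Proof.
move=> aK bK cK phi01 phie lx.
have K0 : 0 <= K by exact: le_trans (md_ge0 _) (aK 0%N).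
have eta0 : 0 <= eta by exact: le_trans (normr_ge0 _) (phie 0%N).
have [lT nT] := lp_tri aK bK cK lx; have [lf nf] := lp_cutoff phi01 lT.
pose d k := tri a b c (cutoff phi x) k - cutoff phi (tri a b c x) k.
have [||||ld nd] := @lp_le3 _ _ p1 (K * eta) 0 (K * eta) d x _ _ _ _ lx.
- exact: mulr_ge0.
- by [].
- exact: mulr_ge0.
- move=> k; rewrite /lsh mul0r addr0.
  have -> : d k = a k * ((phi k.-1 - phi k)%:C%C * sh x k) +
      c k * ((phi k.+1 - phi k)%:C%C * x k.+1).
    by rewrite /d /tri /cutoff; case: k => [|k] /=; rewrite !rmorphB/=; ring.
  apply: le_trans (mdD _ _) _; rewrite !mdM !md_real -!mulrA.
  apply: lerD; rewrite ler_pM ?mulr_ge0 ?md_ge0 ?normr_ge0// ler_wpM2r ?md_ge0//.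
  by case: k => [|k] /=; [rewrite subrr normr0|rewrite distrC].
have -> : tri a b c (cutoff phi x) = fun k => cutoff phi (tri a b c x) k + d k.
  by apply/funext => k; rewrite /d addrC subrK.
have [_ /le_trans] := lp_add p1 lf ld; apply; rewrite lerD//.
by apply: le_trans nd _; rewrite ler_wpM2r ?nrm_ge0//; lra.
Qed.

(** Coefficients are compared only where they meet a nonzero coordinate, so closeness on the rows
    that see the support of [x] suffices. *)
Lemma tri_perturb (K eps : R) a b c a' b' c' x :
  bounded_by K a -> bounded_by K b -> bounded_by K c -> 0 <= eps -> lp p x ->
  (forall k, sh x k != 0 -> md (a k - a' k) <= eps) ->
  (forall k, x k != 0 -> md (b k - b' k) <= eps) ->
  (forall k, x k.+1 != 0 -> md (c k - c' k) <= eps) ->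
  lp p (tri a' b' c' x) /\
  nrm p (tri a' b' c' x) <= nrm p (tri a b c x) + 3 * eps * nrm p x.
Proof.
move=> aK bK cK e0 lx ae be ce.
have [lT _] := lp_tri aK bK cK lx.
have H (d y : R[i]) : (y != 0 -> md d <= eps) -> md (d * y) <= eps * md y.
  have [->|y0 h] := eqVneq y 0; first by rewrite mulr0 md0 mulr0.
  by rewrite mdM ler_wpM2r ?md_ge0// h.
have [|ld nd] := @lp_le3 _ _ p1 eps eps eps
    (fun k => tri a' b' c' x k - tri a b c x k) x e0 e0 e0 _ lx.
  move=> k; have -> : tri a' b' c' x k - tri a b c x k =
      (a' k - a k) * sh x k + (b' k - b k) * x k + (c' k - c k) * x k.+1.
    by rewrite /tri; ring.
  apply: le_trans (mdD _ _) _; apply: lerD; last by rewrite H// mdBC; exact: ce.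
  by apply: le_trans (mdD _ _) _; apply: lerD; rewrite H// mdBC; [exact: ae|exact: be].
have -> : tri a' b' c' x = fun k => tri a b c x k + (tri a' b' c' x k - tri a b c x k).
  by apply/funext => k; rewrite addrC subrK.
have [ls ns] := lp_add p1 lT ld; split=> //.
apply: le_trans ns _; rewrite lerD//.
by apply: le_trans nd _; rewrite ler_wpM2r ?nrm_ge0//; lra.
Qed.

End Tridiagonal.

(** * Windows with nearly constant band; zeros on the unit circle *)

Section Windows.
Context {R : realType} {p : \bar R} (p1 : (1%:E <= p)%E).
Implicit Types (a b c x y : nat -> R[i]).

Definition window a b c (u v w : R[i]) (eps : R) (s n : nat) :=
  forall k, (s <= k < s + n)%N ->
    [/\ md (a k - u) <= eps, md (b k - v) <= eps & md (c k - w) <= eps].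

Definition has_windows a b c u v w :=
  forall (eps : R) n, 0 < eps -> exists s, window a b c u v w eps s n.

Definition bounded_below (M : R) a b c :=
  forall x, lp p x -> nrm p x <= M * nrm p (tri a b c x).

Lemma ler_dist_natdiv (i j n : nat) : (i <= j.+1)%N -> (j <= i.+1)%N ->
  `|i%:R / n%:R - j%:R / n%:R| <= n%:R^-1 :> R.
Proof.
move=> ij ji; rewrite -mulrBl normrM [`|_^-1|]ger0_norm ?invr_ge0//.
rewrite ler_piMl ?invr_ge0// ler_distl.
by rewrite lerBlDr !natr1 !ler_nat ji.
Qed.

Lemma natdiv_itv01 (i n : nat) : (0 < n)%N -> (i <= n)%N ->
  0 <= (i%:R / n%:R : R) <= 1.
Proof.
move=> n0 i_n; rewrite divr_ge0//= ler_pdivrMr ?ltr0n//.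
by rewrite mul1r ler_nat.
Qed.

Definition block (s n : nat) : nat -> R[i] := fun k => (s <= k < s + n)%N%:R.

Lemma lp_block s n : lp p (block s n).
Proof.
apply: (proj1 (lp_finite (m := s + n) p1 _)) => k snk.
by rewrite /block [X in _ && X]ltnNge snk andbF.
Qed.

Lemma nrm_block s n : nrm p (block s n) = nrm p (block 0 n).
Proof.
elim: s => // s <-; apply/eqP; rewrite eq_le; apply/andP; split.
- have -> : block s.+1 n = sh (block s n).
    by apply/funext => -[|k]; rewrite /block//= addSn !ltnS.
  exact: (proj2 (lp_sh p1 (lp_block _ _))).
- have -> : block s n = lsh (block s.+1 n).
    by apply/funext => k; rewrite /block /lsh/= addSn !ltnS.
  exact: (proj2 (lp_lsh p1 (lp_block _ _))).
Qed.

(** Translation invariance and subadditivity stand in for the exact value n^(1/p), so all p are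
    treated alike. *)
Lemma nrm_blockM n m : nrm p (block 0 (m * n)) <= m%:R * nrm p (block 0 n).
Proof.
elim: m => [|m ih].
  rewrite mul0n mul0r; have -> : block 0 0 = fun=> 0 by apply/funext.
  exact: (proj2 (lp_zero p1)).
rewrite mulSn -natr1 mulrDl mul1r addnC.
have -> : block 0 (m * n + n) = fun k => block 0 (m * n) k + block (m * n) n k.
  apply/funext => k; rewrite /block/= add0n -natrD; congr _%:R.
  by case: (ltnP k (m * n)) => h1; case: (ltnP k (m * n + n)) => h2 //; lia.
apply: le_trans (proj2 (lp_add p1 (lp_block _ _) (lp_block _ _))) _.
by rewrite lerD// nrm_block.
Qed.

Lemma nrm_block_gt0 n : (0 < n)%N -> 0 < nrm p (block 0 n).
Proof.
move=> n0; apply: lt_le_trans (le_coord_nrm p1 0 (lp_block 0 n)).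
by rewrite /block/= n0 md1.
Qed.

(* A unimodular zero t of the symbol gives the almost-kernel vectors phi * t^k,
   phi a plateau of slope 1/n on a window of length 3 n + 1. *)
Lemma symbol_neq0 (K M : R) a b c u v w t :
  bounded_by K a -> bounded_by K b -> bounded_by K c ->
  0 <= M -> bounded_below M a b c -> has_windows a b c u v w ->
  md t = 1 -> u + v * t + w * t ^+ 2 != 0.
Proof.
move=> aK bK cK M0 lower win t1; apply/eqP => tr.
have K0 : 0 <= K by exact: le_trans (md_ge0 _) (aK 0%N).
(* [n] and [eps] are chosen for 8 M K / n < 1/2 and 12 M eps < 1/2, the two terms of the final
   estimate. *)
pose n := (Num.truncn (16 * M * K)).+1.
have n0 : (0 < n)%N by [].
have nK : 16 * M * K < n%:R by exact: truncnS_gt.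
pose eps := (24 * (M + 1))^-1.
have eps0 : 0 < eps by rewrite invr_gt0; lra.
have [s sw] := win eps (3 * n).+1 eps0.
pose y k : R[i] := t ^+ k * block s (3 * n).+1 k.
pose phi k : R := (minn n (minn (k - s) (s + 3 * n - k)))%:R / n%:R.
pose P := nrm p (block 0 n).
have P0 : 0 < P by exact: nrm_block_gt0.
have tX k : md (t ^+ k) = 1 by rewrite mdX t1 expr1n.
have [ly ny] : lp p y /\ nrm p y <= 4 * P.
  have [|ly ny] := @lp_le _ _ p1 y (block s (4 * n)) _ (lp_block _ _).
    move=> k; rewrite mdM tX mul1r /block.
    case: (boolP (s <= k < s + (3 * n).+1)%N) => h; last by rewrite md0 md_ge0.
    by have -> : (s <= k < s + 4 * n)%N by clear -h; lia.
  by split=> //; apply: le_trans ny _; rewrite nrm_block; exact: nrm_blockM.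
have phi01 k : 0 <= phi k <= 1 by apply: natdiv_itv01 => //; exact: geq_minl.
have phiL k : `|phi k.+1 - phi k| <= n%:R^-1 by apply: ler_dist_natdiv; clear; lia.
have main := tri_cutoff p1 aK bK cK phi01 phiL ly.
have [_ nl] := lp_cutoff p1 phi01 ly.
have lphi := proj1 (lp_cutoff p1 phi01 ly).
have low := lower _ lphi.
have up : P <= nrm p (cutoff phi y).
  rewrite /P -(nrm_block (s + n)); apply: (proj2 (lp_le p1 _ lphi)) => k.
  rewrite /cutoff /y /block.
  case: (boolP (s + n <= k < s + n + n)%N) => h; last by rewrite md0 md_ge0.
  have -> : (s <= k < s + (3 * n).+1)%N by clear -h; lia.
  rewrite /phi (_ : minn _ _ = n); last by clear -h; lia.
  by rewrite divff ?pnatr_eq0// mulr1 mul1r tX md1.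
have small : nrm p (cutoff phi (tri a b c y)) <= 3 * eps * nrm p y.
  apply: (proj2 (lp_le_scale p1 _ _ ly)) => [|k]; first by rewrite mulr_ge0 ?ltW.
   rewrite {1}/cutoff.
  (* Where phi_k is nonzero, k and both its neighbours lie in the block; [y] is t^i there, and only
     the deviations from (u, v, w) remain in row k. *)
  have [|h] := leqP (minn n (minn (k - s) (s + 3 * n - k))) 0.
    rewrite leqn0 => /eqP h; rewrite /phi h mul0r mul0r md0.
    by rewrite mulr_ge0 ?md_ge0// mulr_ge0 ?ltW.
  have [j kj] : exists j, k = j.+1 by exists k.-1; clear -h; lia.
  have {}h : (s <= j)%N && (j.+2 <= s + 3 * n)%N by clear -h kj; lia.
  have yk : md (y k) = 1.
    have h' : (s <= k < s + (3 * n).+1)%N by clear -h kj; lia.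
    by rewrite /y /block h' mdM tX mul1r md1.
  rewrite yk mulr1 mdM md_real -[leRHS]mul1r ler_pM ?md_ge0//.
    by have /andP[q0 q1] := phi01 k; rewrite ger0_norm.
  have B i : (s <= i < s + (3 * n).+1)%N -> y i = t ^+ i.
    by move=> h'; rewrite /y /block h' mulr1.
  have -> : tri a b c y k = t ^+ j * ((a k - u) + (b k - v) * t + (c k - w) * t ^+ 2).
    rewrite /tri kj /= !B; try (clear -h; lia).
    rewrite !exprS; apply/eqP; rewrite -subr_eq0; apply/eqP.
    transitivity (t ^+ j * (u + v * t + w * t ^+ 2)); first by ring.
    by rewrite tr mulr0.
  rewrite mdM tX mul1r.
  have [ak bk ck] := sw k ltac:(clear -h kj; lia).
  have -> : 3 * eps = eps + eps + eps by ring.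
  apply: le_trans (mdD _ _) _; apply: lerD; last by rewrite mdM tX mulr1.
  by apply: le_trans (mdD _ _) _; apply: lerD => //; rewrite mdM t1 mulr1.
have nn : 0 < n%:R :> R by rewrite ltr0n.
have h1 : P <= M * ((3 * eps + 2 * K / n%:R) * (4 * P)).
  apply: le_trans up _; apply: le_trans low _; rewrite ler_wpM2l//.
  apply: le_trans main _; rewrite [leRHS]mulrDl lerD//.
    by apply: le_trans small _; rewrite ler_wpM2l// mulr_ge0// ltW.
  by rewrite ler_wpM2l// !mulr_ge0// invr_ge0 ltW.
have h2 : 12 * M * eps < 1 / 2.
  rewrite /eps -/(_ / _) ltr_pdivrMr; lra.
have h3 : 8 * M * K / n%:R < 1 / 2.
  rewrite ltr_pdivrMr//; lra.
have : P < P; last by rewrite ltxx.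
apply: le_lt_trans h1 _; rewrite -[ltRHS]mul1r.
have -> : M * ((3 * eps + 2 * K / n%:R) * (4 * P)) =
  (12 * M * eps + 8 * M * K / n%:R) * P by ring.
by rewrite ltr_pM2r//; lra.
Qed.

End Windows.

(** * Zeros of the symbol *)

Section Symbol.
Context {R : realType}.
Implicit Types (u v w al be ga de z : R[i]).

(* w L^2 + v L + u = (al + be L) (ga L + de) *)
Definition factors u v w al be ga de :=
  [/\ u = al * de, v = al * ga + be * de & w = be * ga].

(** For nonzero w a root s is split off: (L - s)(w L + v + w s). Having four coefficients also
    covers w = 0, where a zero moves to infinity. *)
Lemma exists_factors u v w : exists al be ga de, factors u v w al be ga de.
Proof.
have [->|w0] := eqVneq w 0.
  by exists 1, 0, v, u; split; ring.
pose d := sqrtC (v ^+ 2 - 4 * u * w); pose s := (d - v) / (2 * w).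
have d2 : d ^+ 2 = v ^+ 2 - 4 * u * w by rewrite sqrtCK.
have sE : w * s ^+ 2 + v * s + u = 0.
  have : 2 * w * s = d - v by rewrite /s mulrC divfK// mulf_neq0// pnatr_eq0.
  move=> h; have w4 : 4 * w != 0 by rewrite mulf_neq0// pnatr_eq0.
  apply: (mulfI w4); rewrite mulr0.
  transitivity ((2 * w * s) ^+ 2 + 2 * v * (2 * w * s) + 4 * u * w); first by ring.
  rewrite h; transitivity (d ^+ 2 - v ^+ 2 + 4 * u * w); first by ring.
  by rewrite d2; ring.
exists (- s), 1, w, (v + w * s); split; try ring.
by apply/eqP; rewrite -subr_eq0 -{1}[0]sE; apply/eqP; ring.
Qed.

Lemma md_sqr z : md z ^+ 2 = complex.Re z ^+ 2 + complex.Im z ^+ 2.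
Proof. by rewrite /md normc_def/= sqr_sqrtr// addr_ge0// sqr_ge0. Qed.

Lemma md_parallelogram y z :
  md (y + z) ^+ 2 + md (y - z) ^+ 2 = 2 * (md y ^+ 2 + md z ^+ 2).
Proof. by case: y z => [a b] [c d]; rewrite !md_sqr/=; ring. Qed.

(* Square both sides and use the parallelogram law for v, 2 z and for al ga, be de. *)
Lemma focal_sum u v w al be ga de z : factors u v w al be ga de ->
  z ^+ 2 = u * w ->
  md (v + 2 * z) + md (v - 2 * z) = 2 * (md (al * ga) + md (be * de)).
Proof.
move=> [uE vE wE] z2.
apply/eqP; rewrite -(@eqrXn2 _ 2)//; last 2 first.
- by rewrite addr_ge0 ?md_ge0.
- by rewrite mulr_ge0// addr_ge0 ?md_ge0.
apply/eqP.
(* The discriminant v^2 - 4 u w of the symbol is (al ga - be de)^2. *)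
have e1 : md (v + 2 * z) * md (v - 2 * z) = md (al * ga - be * de) ^+ 2.
  rewrite -mdM -mdX; congr md.
  transitivity (v ^+ 2 - 4 * z ^+ 2); first by ring.
  by rewrite z2 uE vE wE; ring.
have e2 := md_parallelogram v (2 * z).
have e3 := md_parallelogram (al * ga) (be * de).
have e4 : md (2 * z) ^+ 2 = 4 * (md (al * ga) * md (be * de)).
  have -> : md (2 * z) = 2 * md z.
    by rewrite mdM -(rmorph_nat (real_complex R)) md_real ger0_norm.
  rewrite exprMn -mdX z2 uE wE -mdM -natrX; congr (_ * md _); ring.
rewrite sqrrD mulr2n.
rewrite -vE in e3.
lra.
Qed.

(** |al ga| + |be de| - |al de| - |be ga| = (|al| - |be|)(|ga| - |de|), a product of positive
    factors. *)
Lemma factors_ellipse_ext u v w al be ga de : factors u v w al be ga de ->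
  md be < md al -> md de < md ga -> ellipse_ext u w v.
Proof.
move=> fact ba dg; rewrite /ellipse_ext/= !normE.
have := focal_sum fact (sqrtCK _); have [-> _ ->] := fact; rewrite !mdM => fs.
rewrite -!rmorphD/= fs -(rmorph_nat (real_complex R)) -rmorphM ltcR ltr_pM2l//.
by rewrite -subr_gt0 (_ : _ - _ = (md al - md be) * (md ga - md de));
  [rewrite mulr_gt0// subr_gt0|ring].
Qed.

End Symbol.

(** * Linear algebra of finitely supported sequences *)

Section FiniteSequences.
Context {R : realType}.
Implicit Types (a b c x y : nat -> R[i]).

Definition finseq n (X : 'rV[R[i]]_n) : nat -> R[i] :=
  fun k => \sum_(j < n) X 0 j * unit_seq j k.

Lemma finseq_ord n (X : 'rV[R[i]]_n) (j : 'I_n) : finseq X j = X 0 j.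
Proof.
rewrite /finseq (bigD1 j)//= /unit_seq eqxx mulr1 big1 ?addr0// => i ij.
by rewrite eq_sym (_ : (i == j :> nat) = false) ?mulr0//; apply/negbTE.
Qed.

Lemma finseq_out n (X : 'rV[R[i]]_n) k : (n <= k)%N -> finseq X k = 0.
Proof.
move=> nk; rewrite /finseq big1// => i _; rewrite /unit_seq gtn_eqF ?mulr0//.
exact: leq_trans (ltn_ord i) nk.
Qed.

Lemma tri_finseq a b c n (X : 'rV[R[i]]_n) k :
  tri a b c (finseq X) k = \sum_(j < n) X 0 j * tri a b c (unit_seq j) k.
Proof.
have shE : sh (finseq X) k = \sum_(j < n) X 0 j * sh (unit_seq j) k.
  by case: k => [|k] //=; rewrite big1// => j _; rewrite mulr0.
rewrite /tri shE /finseq !mulr_sumr -!big_split/=.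
by apply: eq_bigr => j _; ring.
Qed.

(** There are m + 1 unknowns and m equations. *)
Lemma tri_kernel a b c m : exists x, [/\ exists j, x j != 0,
  forall k, (m < k)%N -> x k = 0 & forall k, (k < m)%N -> tri a b c x k = 0].
Proof.
pose A : 'M[R[i]]_(m.+1, m) := \matrix_(j, k) tri a b c (unit_seq j) k.
have : kermx A != 0.
  by rewrite kermx_eq0 /row_free neq_ltn (leq_ltn_trans (rank_leq_col A)).
case/rowV0Pn => X /sub_kermxP XA X0.
exists (finseq X); split.
- have [j Xj] : exists j, X 0 j != 0.
    apply: contrapT => h; move/negP: X0; apply; apply/eqP/rowP => j.
    by rewrite mxE; apply: contrapT => /eqP Xj; apply: h; exists j.
  by exists j; rewrite finseq_ord.
- by move=> k mk; rewrite finseq_out.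
- move=> k km; rewrite tri_finseq.
  have := congr1 (fun Y : 'rV_m => Y 0 (Ordinal km)) XA; rewrite !mxE => XAk.
  rewrite -[RHS]XAk.
  by apply: eq_bigr => j _; rewrite mxE.
Qed.

(** The system is square, so injectivity gives surjectivity. *)
Lemma tri_section_solvable a b c r y :
  (forall x, (forall k, (r <= k)%N -> x k = 0) ->
     (forall k, (k < r)%N -> tri a b c x k = 0) -> forall k, x k = 0) ->
  exists x, (forall k, (r <= k)%N -> x k = 0) /\
     forall k, (k < r)%N -> tri a b c x k = y k.
Proof.
move=> inj; pose A : 'M[R[i]]_r := \matrix_(j, k) tri a b c (unit_seq j) k.
have AE (X : 'rV_r) k (kr : (k < r)%N) :
    tri a b c (finseq X) k = (X *m A) 0 (Ordinal kr).
  by rewrite tri_finseq mxE; apply: eq_bigr => j _; rewrite mxE.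
have Au : A \in unitmx.
  rewrite -row_free_unit -kermx_eq0; apply/negP => /negP/rowV0Pn.
  case=> X /sub_kermxP XA; apply/negP; rewrite negbK; apply/eqP/rowP => j.
  rewrite mxE -finseq_ord inj// => k; first exact: finseq_out.
  by move=> kr; rewrite AE XA mxE.
exists (finseq ((\row_j y j) *m invmx A)); split=> k kr; first exact: finseq_out.
by rewrite (AE _ _ kr) mulmxKV// mxE.
Qed.

End FiniteSequences.

(** * Exclusion of two zeros inside the unit disc *)

Section Decay.
Context {R : realType}.
Implicit Types (a b c x y : nat -> R[i]).

(** With e = (eta / 2)(1 - sigma), the value (eta / 2) B is a fixed point of the recursion, so f i
    <= sigma^i B + (eta / 2) B; [n] is taken with sigma^n < eta / 2. *)
Lemma contraction_small (sigma eta : R) : 0 <= sigma < 1 -> 0 < eta ->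
  exists n (e : R), 0 < e /\
  forall N (f : nat -> R) (B : R), 0 <= B -> f 0%N <= B ->
    (forall i, (i < N)%N -> f i.+1 <= sigma * f i + e * B) ->
    forall i, (n <= i <= N)%N -> f i <= eta * B.
Proof.
move=> /andP[s0 s1] eta0; have e2 : 0 < eta / 2 by rewrite divr_gt0.
have [n nP] : exists n, sigma ^+ n < eta / 2.
  have /cvgrPdist_lt/(_ _ e2)[n _ /(_ n)] :=
    @cvg_expr R sigma ltac:(by rewrite ger0_norm).
  rewrite /= leqnn sub0r normrN => /(_ isT) h.
  by exists n; apply: le_lt_trans h; exact: ler_norm.
exists n, (eta / 2 * (1 - sigma)); split; first by rewrite mulr_gt0// subr_gt0.
move=> N f B B0 f0 fS i /andP[ni iN].
have fi j : (j <= N)%N -> f j <= sigma ^+ j * B + eta / 2 * B.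
  elim: j => [|j ih] jN.
    by rewrite expr0 mul1r; apply: le_trans f0 _; rewrite lerDl mulr_ge0// ltW.
  apply: le_trans (fS _ jN) _.
  apply: le_trans (_ : sigma * (sigma ^+ j * B + eta / 2 * B) +
    eta / 2 * (1 - sigma) * B <= _).
    by rewrite lerD2r ler_wpM2l// ih// ltnW.
  by rewrite exprS le_eqVlt; apply/orP; left; apply/eqP; ring.
apply: le_trans (fi _ iN) _.
have h : sigma ^+ i <= eta / 2.
  by apply: le_trans (ltW nP); rewrite ler_wiXn2l// ltW.
have := ler_wpM2r B0 h; lra.
Qed.

(* The estimate max |x| <= M |Tx|_1 for vectors whose image is concentrated
   at the right end of the support; it holds for T and for its transpose. *)
Definition end_bounded (M : R) a b c := forall m x,
  (forall k, (m < k)%N -> x k = 0) -> (forall k, (k < m)%N -> tri a b c x k = 0) ->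
  forall j, md (x j) <= M * (md (tri a b c x m) + md (tri a b c x m.+1)).

(* If both zeros of the symbol were inside the unit disc, a vector with Tx = 0
   above row m would decay along a window ending at m. *)
Lemma not_both_inside (K M : R) a b c u v w al be ga de :
  bounded_by K a -> bounded_by K b -> bounded_by K c ->
  0 <= M -> end_bounded M a b c -> has_windows a b c u v w ->
  factors u v w al be ga de -> ~ (md al < md be /\ md de < md ga).
Proof.
move=> aK bK cK M0 wp win [uE vE wE] [ab dg].
have K0 : 0 <= K by exact: le_trans (md_ge0 _) (aK 0%N).
have be0 : 0 < md be by exact: le_lt_trans (md_ge0 _) ab.
have ga0 : 0 < md ga by exact: le_lt_trans (md_ge0 _) dg.
have MK : 0 < 3 * K * M + 1 by rewrite ltr_wpDl// !mulr_ge0.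
(* Chosen for 3 K M eta < 1, against the bound B <= 3 K M eta B reached at the end. *)
pose eta := (3 * K * M + 1)^-1.
have eta0 : 0 < eta by rewrite invr_gt0.
have s1 : 0 <= md al / md be < 1.
  by rewrite divr_ge0 ?md_ge0//= ltr_pdivrMr// mul1r.
have s2 : 0 <= md de / md ga < 1.
  by rewrite divr_ge0 ?md_ge0//= ltr_pdivrMr// mul1r.
(* Tolerances are fixed backwards: the decay of [x] at rate |de / ga| tolerates an error e2 B, which
   prescribes how small [y] must be, hence [n1], [e1] and finally [eps]. *)
have [n2 [e2 [e20 dec2]]] := contraction_small s2 eta0.
pose D := md de + md ga.
have D0 : 0 < D by rewrite ltr_wpDl// md_ge0.
have eta10 : 0 < e2 * md ga / D by rewrite divr_gt0// mulr_gt0.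
have [n1 [e1 [e10 dec1]]] := contraction_small s1 eta10.
pose eps := e1 * D * md be / 3.
have eps0 : 0 < eps by rewrite divr_gt0// !mulr_gt0.
have [s sw] := win eps (n1 + n2 + 2)%N eps0.
(* The window consists of the rows s, ..., m: [y] becomes small by index t, then [x] by index m -
   1. *)
pose t := (s + n1)%N; pose m := (t + n2).+1.
have [x [[j0 xj0] x0 Tx0]] := tri_kernel a b c m.
pose B := \big[Num.max/0]_(j < m.+1) md (x j).
have xB j : md (x j) <= B.
  have [mj|jm] := ltnP m j; first by rewrite x0// md0; exact: bigmax_ge_id.
  pose i : 'I_m.+1 := Ordinal (jm : (j < m.+1)%N).
  exact: (le_bigmax _ (fun j : 'I_m.+1 => md (x j)) i).
have B0 : 0 <= B by exact: le_trans (md_ge0 _) (xB j0).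
(* Applying the factor ga L + de first turns row k + 1 of T x = 0 into al y_k + be y_{k+1} = 0, up
   to the deviation of the band from (u, v, w). *)
pose y k := de * x k + ga * x k.+1.
have yB k : md (y k) <= D * B.
  apply: le_trans (mdD _ _) _; rewrite !mdM mulrDl.
  by apply: lerD; rewrite ler_wpM2l ?md_ge0.
have step1 i : (i < n1 + n2)%N ->
    md (y (s + i.+1)%N) <= md al / md be * md (y (s + i)%N) + e1 * (D * B).
  move=> ilt; have [ak bk ck] := sw (s + i.+1)%N ltac:(clear -ilt; lia).
  have Tk := Tx0 (s + i.+1)%N ltac:(rewrite /m /t; clear -ilt; lia).
  rewrite addnS; move: ak bk ck Tk; rewrite addnS.
  move: (s + i)%N => k ak bk ck Tk.
  have gE : al * y k + be * y k.+1 =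
      - ((a k.+1 - u) * x k + (b k.+1 - v) * x k.+1 + (c k.+1 - w) * x k.+2).
    rewrite -[LHS](subr0) -Tk /tri /y uE vE wE/=; ring.
  have gle : md (al * y k + be * y k.+1) <= 3 * eps * B.
    have -> : 3 * eps * B = eps * B + eps * B + eps * B by ring.
    rewrite gE mdN; apply: le_trans (mdD _ _) _; apply: lerD; last first.
      by rewrite mdM ler_pM ?md_ge0.
    by apply: le_trans (mdD _ _) _; apply: lerD; rewrite mdM ler_pM ?md_ge0.
  rewrite -(ler_pM2l be0) mulrDr -mdM.
  have -> : be * y k.+1 = (al * y k + be * y k.+1) - al * y k by ring.
  apply: le_trans (mdB _ _) _; rewrite addrC mdM; apply: lerD.
    by rewrite mulrA mulrCA divff ?mulr1// gt_eqF.
  apply: le_trans gle _; rewrite le_eqVlt /eps; apply/orP; left; apply/eqP.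
  by field.
have DB0 : 0 <= D * B by rewrite mulr_ge0// ltW.
have ysmall i : (n1 <= i <= n1 + n2)%N -> md (y (s + i)%N) <= e2 * md ga * B.
  move=> ile.
  have := dec1 (n1 + n2)%N (fun i => md (y (s + i)%N)) _ DB0 (yB _) step1 i ile.
  suff -> : e2 * md ga / D * (D * B) = e2 * md ga * B by [].
  by field; rewrite gt_eqF.
have step2 i : (i < n2.+1)%N ->
    md (x (t + i.+1)%N) <= md de / md ga * md (x (t + i)%N) + e2 * B.
  move=> ilt; have := ysmall (n1 + i)%N ltac:(clear -ilt; lia); rewrite addnA -/t => yle.
  rewrite addnS; set k := (t + i)%N in yle *.
  rewrite -(ler_pM2l ga0) mulrDr -mdM.
  have -> : ga * x k.+1 = y k - de * x k by rewrite /y; ring.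
  apply: le_trans (mdB _ _) _; rewrite addrC mdM; apply: lerD.
    by rewrite mulrA mulrCA divff ?mulr1// gt_eqF.
  by rewrite mulrA [md ga * _]mulrC.
have xsmall i : (n2 <= i <= n2.+1)%N -> md (x (t + i)%N) <= eta * B.
  exact: dec2 _ (fun i => md (x (t + i)%N)) _ B0 (xB _) step2 i.
(* Since x vanishes beyond m, rows m and m + 1 of T x involve only x_{m-1} and x_m. *)
have xm : md (x m) <= eta * B by rewrite /m -addnS xsmall// leqnn andbT.
have xm1 : md (x (t + n2)%N) <= eta * B by rewrite xsmall// leqnn/=.
have KM : 0 <= K * (eta * B) by rewrite !mulr_ge0// ltW.
have Tm : md (tri a b c x m) <= 2 * K * (eta * B).
  rewrite /tri /= (x0 m.+1)// mulr0 addr0.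
  have -> : 2 * K * (eta * B) = K * (eta * B) + K * (eta * B) by ring.
  by apply: le_trans (mdD _ _) _; apply: lerD; rewrite mdM ler_pM ?md_ge0.
have Tm1 : md (tri a b c x m.+1) <= K * (eta * B).
  rewrite /tri /= (x0 m.+1)// (x0 m.+2)// !mulr0 !addr0.
  by rewrite mdM ler_pM ?md_ge0.
have BB : B <= 3 * K * M * eta * B.
  apply: bigmax_le => [|j _]; first by rewrite !mulr_ge0// ltW.
  apply: le_trans (wp m x x0 Tx0 j) _.
  have -> : 3 * K * M * eta * B = M * (2 * K * (eta * B) + K * (eta * B)) by ring.
  by rewrite ler_wpM2l// lerD.
have Bpos : 0 < B by apply: lt_le_trans (xB j0); rewrite md_gt0.
have : 3 * K * M * eta < 1 by rewrite /eta -/(_ / _) ltr_pdivrMr// mul1r ltrDl.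
by rewrite -(ltr_pM2r Bpos) mul1r ltNge BB.
Qed.

End Decay.

(** * From the matrix to its diagonals; windows from pseudoergodicity *)

Section Operator.
Context {R : realType}.
Implicit Types (A : int -> int -> R[i]) (x y : nat -> R[i]).

Lemma ler_dist_md (y z : R[i]) : `|md y - md z| <= md (y - z).
Proof.
have h1 := mdD (y - z) z; have h2 := mdD (z - y) y.
rewrite !subrK in h1 h2; rewrite mdBC in h2.
by rewrite ler_norml; apply/andP; split; lra.
Qed.

Lemma continuous_md : continuous (md : (R[i])^o -> R^o).
Proof.
move=> z; have FF := @nbhs_filter (R[i])^o z.
apply/(@cvgrPdist_lt _ _ _ (nbhs z)) => e e0.
apply/nbhs_ballP; exists (e%:C)%C => /=; first by rewrite ltcR.
move=> y; rewrite -ball_normE/= normE ltcR => zy.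
exact: le_lt_trans (ler_dist_md _ _) zy.
Qed.

Lemma compact_md_bounded (U : set (R[i])^o) : compact U ->
  exists K : R, forall z, U z -> md z <= K.
Proof.
move=> cU.
have /compact_bounded[M [_ MP]] : compact (md @` U : set R^o).
  apply: continuous_compact => //; apply: continuous_subspaceT.
  exact: continuous_md.
exists (M + 1) => z Uz.
have := MP (M + 1) ltac:(by rewrite ltrDl) (md z) ltac:(by exists z).
by rewrite /= ger0_norm ?md_ge0.
Qed.

Lemma sum_extend (F : nat -> R[i]) n N : (n <= N)%N ->
  (forall k, (n <= k < N)%N -> F k = 0) ->
  \sum_(0 <= k < n) F k = \sum_(0 <= k < N) F k.
Proof.
move=> nN F0; rewrite [RHS](big_cat_nat (leq0n n) nN)/= [X in _ + X]big_nat_cond.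
by rewrite [X in _ + X]big1 ?addr0// => k; rewrite andbT => /F0.
Qed.

(** Index k is row k + 1 of the matrix. The value at 0 is the entry (1, 0), outside the half-line
    matrix; [tri] multiplies it by 0. *)
Definition subdiag A k := A k.+1%:Z k%:Z.
Definition maindiag A k := A k.+1%:Z k.+1%:Z.
Definition superdiag A k := A k.+1%:Z k.+2%:Z.
Definition transp A : int -> int -> R[i] := fun i j => A j i.

Lemma mulmv_tridiag (U V W : set (R[i])^o) A x : tridiag U V W A ->
  mulmv (semi A) x = tri (subdiag A) (maindiag A) (superdiag A) x.
Proof. by move=> [_ A0]; exact: mulmv_tri. Qed.

Lemma tridiag_transp (U V W : set (R[i])^o) A : tridiag U V W A ->
  tridiag W V U (transp A).
Proof.
move=> [AM A0]; split=> [i|i j ij]; last by rewrite /transp A0// distrC.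
rewrite /transp; have [_ _] := AM (i - 1); rewrite subrK => Wi.
have [+ _ _] := AM (i + 1); rewrite addrK => Ui.
by have [_ Vi _] := AM i.
Qed.

Lemma tridiag_bounded (U V W : set (R[i])^o) A :
  compact U -> compact V -> compact W -> tridiag U V W A ->
  exists K, [/\ bounded_by K (subdiag A), bounded_by K (maindiag A) &
    bounded_by K (superdiag A)].
Proof.
move=> cU cV cW [AM _].
have [K1 K1P] := compact_md_bounded cU; have [K2 K2P] := compact_md_bounded cV.
have [K3 K3P] := compact_md_bounded cW.
exists (Num.max K1 (Num.max K2 K3)).
split=> k; have [Uk Vk Wk] := AM k.+1%:Z; rewrite !le_max.
- apply/orP; left; apply: K1P; move: Uk.
  by rewrite (_ : k.+1%:Z - 1 = k%:Z)//; lia.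
- by rewrite (K2P _ Vk) orbT.
- have -> : superdiag A k = A k.+1%:Z (k.+1%:Z + 1) by congr (A _ _); lia.
  by rewrite (K3P _ Wk) !orbT.
Qed.

(** Pseudoergodicity for a constant word, of length n + 1 so as to be non-empty; each coordinate
    difference is at most the Euclidean distance. *)
Lemma pseudoergodic_run (U V W : set (R[i])^o) A (u v w : R[i]) (eps : R) n :
  right_pseudoergodic U V W A -> U u -> V v -> W w -> 0 < eps ->
  exists k : nat, forall j : nat, (k < j <= k + n)%N ->
    [/\ md (A j%:Z (j%:Z - 1) - u) < eps, md (A j%:Z j%:Z - v) < eps &
        md (A j%:Z (j%:Z + 1) - w) < eps].
Proof.
move=> pe Uu Vv Ww e0.
have [|||k k0 kP] := pe eps n.+1 (fun=> (u, v, w)) => //.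
exists k => j jP.
have := kP (j - k)%N ltac:(lia); rewrite (_ : (k + (j - k))%N = j); last by lia.
rewrite /dist3 /band/= !normE -!rmorphXn -!rmorphD/=.
set a := md (A j%:Z (j%:Z - 1) - u); set b := md (A j%:Z j%:Z - v).
set c := md (A j%:Z (j%:Z + 1) - w).
move=> h; have s0 : 0 <= a ^+ 2 + b ^+ 2 + c ^+ 2 by rewrite !addr_ge0// sqr_ge0.
have h2 : a ^+ 2 + b ^+ 2 + c ^+ 2 < eps ^+ 2.
  rewrite -ltcR !rmorphXn/= -[ltLHS]sqrtCK ltr_pXn2r ?nnegrE//.
    by rewrite sqrtC_ge0 lecR.
  by rewrite lecR ltW.
have lt d : 0 <= d -> d ^+ 2 <= a ^+ 2 + b ^+ 2 + c ^+ 2 -> d < eps.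
  move=> d0 dle; rewrite -(@ltr_pXn2r _ 2) ?nnegrE ?(ltW e0)//.
  exact: le_lt_trans dle h2.
have := sqr_ge0 a; have := sqr_ge0 b; have := sqr_ge0 c.
by split; apply: lt; rewrite ?md_ge0//; lra.
Qed.

Lemma pseudoergodic_windows (U V W : set (R[i])^o) A (u v w : R[i]) :
  right_pseudoergodic U V W A -> U u -> V v -> W w ->
  has_windows (subdiag A) (maindiag A) (superdiag A) u v w.
Proof.
move=> pe Uu Vv Ww eps n e0.
have [s sP] := pseudoergodic_run n pe Uu Vv Ww e0.
exists s => k kP; have := sP k.+1 ltac:(lia).
rewrite (_ : k.+1%:Z - 1 = k%:Z); last by lia.
rewrite (_ : k.+1%:Z + 1 = k.+2%:Z); last by lia.
by move=> [/ltW ? /ltW ? /ltW ?]; split.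
Qed.

(** A row of the transpose collects entries from three consecutive rows of [A], hence a run longer
    by two. *)
Lemma pseudoergodic_windows_transp (U V W : set (R[i])^o) A (u v w : R[i]) :
  right_pseudoergodic U V W A -> U u -> V v -> W w ->
  has_windows (subdiag (transp A)) (maindiag (transp A)) (superdiag (transp A)) w v u.
Proof.
move=> pe Uu Vv Ww eps n e0.
have [s sP] := pseudoergodic_run n.+2 pe Uu Vv Ww e0.
exists s.+1 => k kP.
have := sP k ltac:(lia); have := sP k.+1 ltac:(lia); have := sP k.+2 ltac:(lia).
rewrite (_ : k.+2%:Z - 1 = k.+1%:Z); last by lia.
rewrite (_ : k%:Z + 1 = k.+1%:Z); last by lia.
by move=> [/ltW ? _ _] [_ /ltW ? _] [_ _ /ltW ?]; split.
Qed.

End Operator.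

(** * Invertibility and the position of the zeros of the symbol *)

Section Invertible.
Context {R : realType} {p : \bar R} (p1 : (1%:E <= p)%E).
Implicit Types (A : int -> int -> R[i]) (x y : nat -> R[i]).

Lemma invertible_bound (T : (nat -> R[i]) -> nat -> R[i]) : invertible_on p T ->
  exists (S : (nat -> R[i]) -> nat -> R[i]) (M : R), 0 <= M /\
    forall x, lp p x ->
    [/\ lp p (S x), nrm p (S x) <= M * nrm p x, T (S x) = x & S (T x) = x].
Proof.
move=> [S [[Slp _ [M MP]] TS]]; exists S, (Num.max M 0); split.
  by rewrite le_max lexx orbT.
move=> x lx; have [? ?] := TS x lx; split=> //; first exact: Slp.
have := MP x lx; rewrite (nrmE (Slp x lx)) (nrmE lx) -EFinM lee_fin => h.
by apply: le_trans h _; rewrite ler_wpM2r ?nrm_ge0// le_max lexx.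
Qed.

(** The image lives on rows m and m + 1, so its l^p norm is at most the sum of two moduli. *)
Lemma end_bounded_tri (M : R) (a b c : nat -> R[i]) : 0 <= M ->
  bounded_below (p := p) M a b c -> end_bounded M a b c.
Proof.
move=> M0 low m x x0 Tx0 j.
have [lx _] := lp_finite (m := m.+1) p1 x0.
have [lT nT] : lp p (tri a b c x) /\
    nrm p (tri a b c x) <= \sum_(k < m.+2) md (tri a b c x k).
  apply: lp_finite => // -[//|k] mk; rewrite /tri /= !x0 ?mulr0 ?addr0//; lia.
apply: le_trans (le_coord_nrm p1 j lx) _; apply: le_trans (low _ lx) _.
rewrite ler_wpM2l//; apply: le_trans nT _.
rewrite !big_ord_recr/= big1 ?add0r// => k _.
by rewrite Tx0 ?md0//; exact: ltn_ord.
Qed.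

(* y_j = <y, T S e_j> = <T^t y, S e_j>. *)
Lemma end_bounded_transp (U V W : set (R[i])^o) A (S : (nat -> R[i]) -> nat -> R[i]) M :
  tridiag U V W A -> 0 <= M ->
  (forall x, lp p x -> [/\ lp p (S x), nrm p (S x) <= M * nrm p x,
     mulmv (semi A) (S x) = x & S (mulmv (semi A) x) = x]) ->
  end_bounded M (subdiag (transp A)) (maindiag (transp A)) (superdiag (transp A)).
Proof.
move=> AM M0 SP m y y0; rewrite -(mulmv_tridiag y (tridiag_transp AM)).
set z := mulmv _ y => z0 j.
have [mj|jm] := ltnP m j.
  by rewrite y0// md0 mulr_ge0 ?addr_ge0 ?md_ge0.
have [lu nu] := lp_unit p1 j; have [lx nx Tx _] := SP _ lu.
set x := S (unit_seq j) in lx nx Tx.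
(* This bound on the entries of the inverse replaces a norm bound for the adjoint and holds for
   every p, including oo. *)
have xM l : md (x l) <= M.
  apply: le_trans (le_coord_nrm p1 l lx) _; apply: le_trans nx _.
  by rewrite -[leRHS]mulr1 ler_wpM2l.
have A0 k l : (k.+2 <= l)%N || (l.+2 <= k)%N -> semi A k l = 0.
  by move=> kl; rewrite /semi (proj2 AM)//; lia.
have yE : y j = \sum_(0 <= k < m.+1) y k * mulmv (semi A) x k.
  rewrite Tx big_mkord (bigD1 (Ordinal (jm : (j < m.+1)%N)))//=.
  rewrite /unit_seq eqxx mulr1 big1 ?addr0// => i ij.
  by rewrite (_ : (i == j :> nat) = false) ?mulr0//; apply/negbTE.
have zE l : (l < m.+2)%N -> z l = \sum_(0 <= k < m.+1) semi A k l * y k.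
  move=> lm; rewrite /z /mulmv -[LHS]/(\sum_(0 <= k < l.+2) semi A k l * y k).
  rewrite (@sum_extend _ _ l.+2 m.+3) => [||k kl]; last 2 first.
  - by lia.
  - by rewrite A0 ?mul0r//; lia.
  by rewrite (@sum_extend _ _ m.+1 m.+3) => [//||k kl]; [lia|rewrite y0 ?mulr0//; lia].
have {}yE : y j = \sum_(0 <= l < m.+2) z l * x l.
  transitivity (\sum_(0 <= l < m.+2) \sum_(0 <= k < m.+1) semi A k l * y k * x l).
    rewrite yE.
    rewrite exchange_big/=; apply: eq_big_nat => k km.
    rewrite /mulmv (@sum_extend _ _ k.+2 m.+2) => [||l kl]; last 2 first.
    - by lia.
    - by rewrite A0 ?mul0r//; lia.
    by rewrite mulr_sumr; apply: eq_bigr => l _; ring.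
  by apply: eq_big_nat => l lm; rewrite zE// mulr_suml.
rewrite yE !big_nat_recr//= big_nat_cond big1 ?add0r; last first.
  by move=> k; rewrite andbT => /= km; rewrite z0 ?mul0r.
rewrite mulrDr; apply: le_trans (mdD _ _) _.
by apply: lerD; rewrite mdM mulrC ler_wpM2r ?md_ge0.
Qed.

(** Equal moduli would give a unimodular zero. Of the four strict cases, two zeros inside the disc
    are excluded by T, two outside by its transpose; the remaining two differ by exchanging the
    factors. *)
Lemma good_factors (U V W : set (R[i])^o) A (u v w : R[i]) :
  compact U -> compact V -> compact W -> tridiag U V W A ->
  right_pseudoergodic U V W A -> invertible_on p (mulmv (semi A)) ->
  U u -> V v -> W w ->
  exists al be ga de, [/\ factors u v w al be ga de, md be < md al & md de < md ga].
Proof.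
move=> cU cV cW AM pe Ainv Uu Vv Ww.
have [K [aK bK cK]] := tridiag_bounded cU cV cW AM.
have [K' [aK' bK' cK']] := tridiag_bounded cW cV cU (tridiag_transp AM).
have [S [M [M0 SP]]] := invertible_bound Ainv.
have low : bounded_below (p := p) M (subdiag A) (maindiag A) (superdiag A).
  move=> x lx; have [lT _] := lp_tri p1 aK bK cK lx.
  by have [_ + _ _] := SP _ lT; rewrite -(mulmv_tridiag x AM); have [_ _ _ ->] := SP _ lx.
have win := pseudoergodic_windows pe Uu Vv Ww.
have win' := pseudoergodic_windows_transp pe Uu Vv Ww.
have [al [be [ga [de fact]]]] := exists_factors u v w.
have [uE vE wE] := fact.
have root t : md t = 1 -> (al + be * t) * (ga * t + de) != 0.
  move=> t1; have := symbol_neq0 p1 aK bK cK M0 low win t1.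
  by rewrite uE vE wE; congr (_ != 0); ring.
have unimod (y z : R[i]) : md y = md z -> exists2 t, md t = 1 & y + z * t = 0.
  move=> yz; have [z0|z0] := eqVneq z 0.
    exists 1; first exact: md1.
    by move: yz; rewrite z0 md0 mul0r addr0 => /eqP; rewrite md_eq0 => /eqP.
  exists (- (y / z)); last by field.
  by rewrite mdN mdM mdV yz divff// md_eq0.
have : md al != md be.
  apply/eqP => /unimod[t t1 t0]; have := root t t1.
  by rewrite t0 mul0r eqxx.
have : md de != md ga.
  apply/eqP => /unimod[t t1 t0]; have := root t t1.
  by rewrite addrC addrC [X in _ * X]addrC t0 mulr0 eqxx.
rewrite !neq_lt => /orP[dg|gd] /orP[ab|ba].
- case: (not_both_inside aK bK cK M0 (end_bounded_tri M0 low) win fact).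
  by split.
- by exists al, be, ga, de; split.
- exists de, ga, be, al; split=> //; split; rewrite ?uE ?vE ?wE; ring.
(* Transposition exchanges u and w, which inverts the zeros of the symbol. *)
- have fact' : factors w v u be al de ga by split; rewrite ?uE ?vE ?wE; ring.
  have wp := end_bounded_transp AM M0 SP.
  by case: (not_both_inside aK' bK' cK' M0 wp win' fact').
Qed.

End Invertible.

(** * Finite sections *)

Section Stability.
Context {R : realType} {p : \bar R} (p1 : (1%:E <= p)%E).
Implicit Types (a b c x y : nat -> R[i]).

(** The triangle inequality gives |al| |y| <= |z| + |be| |y'| <= |z| + |be| |y|. *)
Lemma lower_bound_perturb (al be : R[i]) y y' z : al != 0 -> lp p y' -> lp p z ->
  nrm p y' <= nrm p y -> (forall k, al * y k = z k - be * y' k) ->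
  (md al - md be) * nrm p y <= nrm p z.
Proof.
move=> al0 ly' lz yy' yE.
have [l1 n1] := lp_scale p1 al^-1 lz; have [l2 n2] := lp_scale p1 (- (be / al)) ly'.
have [_ n12] := lp_add p1 l1 l2.
have yE' : y = fun k => al^-1 * z k + - (be / al) * y' k.
  by apply/funext => k; apply: (mulfI al0); rewrite yE; field.
rewrite -yE' mdN mdM mdV in n12 n2; rewrite mdV in n1.
have al1 : 0 < md al by rewrite md_gt0.
have h : nrm p y <= (md al)^-1 * nrm p z + md be / md al * nrm p y.
  apply: le_trans n12 _; apply: lerD => //; apply: le_trans n2 _.
  by rewrite ler_wpM2l// divr_ge0// md_ge0.
have := ler_wpM2l (ltW al1) h.
have -> : md al * ((md al)^-1 * nrm p z + md be / md al * nrm p y) =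
  nrm p z + md be * nrm p y by field; rewrite gt_eqF.
by lra.
Qed.

(* On sequences vanishing from r on, the truncated Toeplitz operator is the
   product of the truncation of ga + de sh and of al + be lsh. *)
Lemma toeplitz_half_line u v w al be ga de r y :
  factors u v w al be ga de -> md be < md al -> md de < md ga -> lp p y ->
  y 0%N = 0 -> (forall k, (r <= k)%N -> y k = 0) ->
  (md al - md be) * (md ga - md de) * nrm p y <=
  nrm p (truncate r (tri (fun=> u) (fun=> v) (fun=> w) y)).
Proof.
move=> [uE vE wE] ba dg ly y0 yr.
have al0 : al != 0 by rewrite -md_gt0; apply: le_lt_trans ba; exact: md_ge0.
have ga0 : ga != 0 by rewrite -md_gt0; apply: le_lt_trans dg; exact: md_ge0.
pose z k := al * y k + be * lsh y k.
have [ll nl] := lp_lsh p1 ly.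
have lz : lp p z.
  have [l1 _] := lp_scale p1 al ly; have [l2 _] := lp_scale p1 be ll.
  by have [] := lp_add p1 l1 l2.
have h1 : (md al - md be) * nrm p y <= nrm p z.
  by apply: (lower_bound_perturb al0 ll lz nl) => k; rewrite /z addrK.
pose y' := truncate r (sh z).
have [ls ns] := lp_sh p1 lz.
have [ly' ny'] : lp p y' /\ nrm p y' <= nrm p (sh z).
  by apply: lp_le => // k; rewrite /y' /truncate; case: ifP => //; rewrite md0 md_ge0.
set Tc := truncate r _.
(* Cutting [sh z] at r removes z_{r-1} from row r, where [Tc] vanishes. In row 0 the product lacks
   be de y_0, which is 0 by [y0]. *)
have TcE k : Tc k = ga * z k + de * y' k.
  rewrite /Tc /y' /truncate /z /lsh; case: ltnP => kr; last first.
    by rewrite !yr//; [ring|exact: leqW].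
  by rewrite /tri uE vE wE; case: k kr => [|k] kr /=; rewrite ?y0; ring.
have lTc : lp p Tc.
  have [l1 _] := lp_scale p1 ga lz; have [l2 _] := lp_scale p1 de ly'.
  by rewrite (funext TcE); have [] := lp_add p1 l1 l2.
have h2 : (md ga - md de) * nrm p z <= nrm p Tc.
  apply: (lower_bound_perturb ga0 ly' lTc); first exact: le_trans ny' ns.
  by move=> k; rewrite TcE addrK.
by apply: le_trans h2; rewrite mulrAC mulrC ler_wpM2l// subr_ge0 ltW.
Qed.

(** Truncating the image only erases coefficients, so the cutoff estimates apply to finite sections
    too. *)
Lemma truncate_tri r a b c x :
  truncate r (tri a b c x) = tri (truncate r a) (truncate r b) (truncate r c) x.
Proof.
apply/funext => k; rewrite /truncate /tri; case: ifP => // _.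
by rewrite !mul0r !addr0.
Qed.

Lemma truncate_bounded (K : R) r a : bounded_by K a -> bounded_by K (truncate r a).
Proof.
move=> aK k; rewrite /truncate; case: ifP => // _.
by rewrite md0; exact: le_trans (md_ge0 _) (aK 0%N).
Qed.

(* Split x = phi x + (1 - phi) x with phi rising from 0 to 1 over the last n
   positions: the first part sees the Toeplitz operator on a half-line, the
   second one does not see the truncation. *)
Lemma section_stable (K M : R) a b c u v w al be ga de :
  bounded_by K a -> bounded_by K b -> bounded_by K c ->
  0 <= M -> bounded_below (p := p) M a b c ->
  factors u v w al be ga de -> md be < md al -> md de < md ga ->
  exists n (eps C : R), [/\ 0 < eps, 0 <= C & forall r, (n.+1 < r)%N ->
    window a b c u v w eps (r - n.+1) n.+1 ->
    forall x, (forall k, (r <= k)%N -> x k = 0) ->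
    nrm p x <= C * nrm p (truncate r (tri a b c x))].
Proof.
move=> aK bK cK M0 low fact ba dg.
have K0 : 0 <= K by exact: le_trans (md_ge0 _) (aK 0%N).
pose c0 := (md al - md be) * (md ga - md de).
have c00 : 0 < c0 by rewrite mulr_gt0// subr_gt0.
pose D := 2 / c0 + M.
have D0 : 0 <= D by rewrite addr_ge0// divr_ge0// ltW.
(* Gives D (2 K / n) <= 1/2, so that the commutator terms are absorbed at the end. *)
pose n := (Num.truncn (4 * K * D)).+1.
have nK : 4 * K * D < n%:R by exact: truncnS_gt.
have n0 : 0 < n%:R :> R by rewrite ltr0n.
(* 3 eps = c0 / 2: the perturbation costs half of the Toeplitz bound. *)
pose eps := c0 / 6.
have eps0 : 0 < eps by rewrite divr_gt0.
exists n, eps, (2 * D); split => //; first by rewrite mulr_ge0.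
move=> r nr win x xr.
rewrite truncate_tri; set T := tri _ _ _.
have lx : lp p x by have [] := lp_finite p1 xr.
have [aK' bK' cK'] : [/\ bounded_by K (truncate r a), bounded_by K (truncate r b)
  & bounded_by K (truncate r c)] by split; exact: truncate_bounded.
have [lTx _] := lp_tri p1 aK' bK' cK' lx.
(* By truncated subtraction [phi] is 0 below r - n and 1 from r - 1 on. *)
pose phi k : R := (n - (r.-1 - k))%:R / n%:R.
pose psi k : R := 1 - phi k.
have phi01 k : 0 <= phi k <= 1 by apply: natdiv_itv01 => //; exact: leq_subr.
have psi01 k : 0 <= psi k <= 1.
  by have /andP[q0 q1] := phi01 k; rewrite /psi; lra.
have phiL k : `|phi k.+1 - phi k| <= n%:R^-1 by apply: ler_dist_natdiv; clear; lia.
have psiL k : `|psi k.+1 - psi k| <= n%:R^-1.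
  by rewrite (_ : psi _ - _ = phi k - phi k.+1); [rewrite distrC|rewrite /psi; ring].
have [lf _] := lp_cutoff p1 phi01 lx; have [lg _] := lp_cutoff p1 psi01 lx.
have Tf := tri_cutoff p1 aK' bK' cK' phi01 phiL lx.
have Tg := tri_cutoff p1 aK' bK' cK' psi01 psiL lx.
have [_ nf] := lp_cutoff p1 phi01 lTx; have [_ ng] := lp_cutoff p1 psi01 lTx.
have f0 k : (k < r - n)%N || (r <= k)%N -> cutoff phi x k = 0.
  case/orP=> h; last by rewrite /cutoff xr// mulr0.
  rewrite /cutoff /phi (_ : (n - (r.-1 - k))%N = 0%N) ?mul0r ?mul0r//.
  by clear -h nr; lia.
have hf : c0 / 2 * nrm p (cutoff phi x) <= nrm p (T (cutoff phi x)).
  have := @toeplitz_half_line u v w al be ga de r (cutoff phi x) fact ba dg lf.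
  rewrite truncate_tri -/c0 => h.
  have {}h : c0 * nrm p (cutoff phi x) <= nrm p (tri (truncate r (fun=> u))
      (truncate r (fun=> v)) (truncate r (fun=> w)) (cutoff phi x)).
    by apply: h => [|k rk]; apply: f0; [clear -nr; lia|rewrite rk orbT].
  (* Row r - n - 1 meets the support of phi x through its superdiagonal entry, hence n + 1 rows in
     the window. *)
  have near (k : nat) : (r - n.+1 <= k)%N -> (k < r)%N ->
      [/\ md (a k - u) <= eps, md (b k - v) <= eps & md (c k - w) <= eps].
    by move=> h1 h2; apply: win; clear -h1 h2 nr; lia.
  have [|||_ hp] := tri_perturb (a' := truncate r (fun=> u)) (b' := truncate r (fun=> v))
      (c' := truncate r (fun=> w)) p1 aK' bK' cK' (ltW eps0) lf.
  - move=> k; rewrite /truncate; case: ifP => kr; last by rewrite subrr md0 ltW.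
    have [h1|h1] := leqP (r - n.+1) k; first by have [] := near k h1 kr.
    case: k h1 kr => [|k] h1 kr /=; first by rewrite eqxx.
    by rewrite f0 ?eqxx//; clear -h1; lia.
  - move=> k; rewrite /truncate; case: ifP => kr; last by rewrite subrr md0 ltW.
    have [h1|h1] := leqP (r - n.+1) k; first by have [] := near k h1 kr.
    by rewrite f0 ?eqxx//; clear -h1; lia.
  - move=> k; rewrite /truncate; case: ifP => kr; last by rewrite subrr md0 ltW.
    have [h1|h1] := leqP (r - n.+1) k; first by have [] := near k h1 kr.
    by rewrite f0 ?eqxx//; clear -h1; lia.
  by rewrite -/T /eps in hp; have := nrm_ge0 (p := p) (cutoff phi x); lra.
have hg : nrm p (cutoff psi x) <= M * nrm p (T (cutoff psi x)).
  rewrite /T -truncate_tri.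
  (* [psi] vanishes already at r - 1, so row r of the image is 0 and the truncation changes
     nothing. *)
  suff <- : tri a b c (cutoff psi x) = truncate r (tri a b c (cutoff psi x)).
    exact: low.
  apply/funext => k; rewrite /truncate; case: ltnP => // rk.
  have g0 j : (r.-1 <= j)%N -> cutoff psi x j = 0.
    move=> rj; rewrite /cutoff /psi /phi (_ : (r.-1 - j)%N = 0%N).
      by rewrite subn0 divff ?gt_eqF// subrr mul0r.
    by clear -rj; lia.
  rewrite /tri !g0 ?mulr0 ?addr0//; try (clear -rk; lia).
  by case: k rk => [|k] rk /=; rewrite ?mulr0// g0 ?mulr0//; clear -rk; lia.
have xE : x = fun k => cutoff phi x k + cutoff psi x k.
  by apply/funext => k; rewrite /cutoff /psi -mulrDl -rmorphD/= addrC subrK mul1r.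
have := proj2 (lp_add p1 lf lg); rewrite -xE => nx.
set X := nrm p x in Tf Tg nx *; set Y := nrm p (T x).
have X0 : 0 <= X by exact: nrm_ge0.
pose t := Y + 2 * K / n%:R * X.
have h1 : nrm p (cutoff phi x) <= 2 / c0 * t.
  have h : c0 / 2 * nrm p (cutoff phi x) <= t.
    by apply: le_trans hf _; apply: le_trans Tf _; rewrite lerD.
  rewrite -(ler_pM2l (_ : 0 < c0 / 2)); last by rewrite divr_gt0.
  apply: le_trans h _; rewrite le_eqVlt; apply/orP; left; apply/eqP.
  by field; rewrite gt_eqF.
have h2 : nrm p (cutoff psi x) <= M * t.
  apply: le_trans hg _; rewrite ler_wpM2l//.
  by apply: le_trans Tg _; rewrite lerD.
have h3 : X <= D * t.
  by apply: le_trans nx _; rewrite /D mulrDl lerD.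
have h4 : D * (2 * K / n%:R) <= 1 / 2.
  by rewrite mulrA ler_pdivrMr//; lra.
have h5 := ler_wpM2r X0 h4.
rewrite /t mulrDr mulrA in h3.
lra.
Qed.

(* A tent of slope 1/r centred at 0 localises the error away from r. *)
Lemma section_error (K M : R) a b c r e j :
  bounded_by K a -> bounded_by K b -> bounded_by K c ->
  0 <= M -> bounded_below (p := p) M a b c -> lp p e ->
  (forall k, (k < r)%N -> tri a b c e k = 0) -> (0 < r)%N -> (2 * j <= r)%N ->
  md (e j) <= 4 * K * M * nrm p e / r%:R.
Proof.
move=> aK bK cK M0 low lpe Te r0 jr.
pose psi k : R := (r - k)%:R / r%:R.
have psi01 k : 0 <= psi k <= 1 by apply: natdiv_itv01 => //; exact: leq_subr.
have psiL k : `|psi k.+1 - psi k| <= r%:R^-1 by apply: ler_dist_natdiv; lia.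
have main := tri_cutoff p1 aK bK cK psi01 psiL lpe.
have [lc _] := lp_cutoff p1 psi01 lpe.
(* The tent vanishes from r on, where nothing is known about the image; it is at least 1/2 at j
   because 2 j <= r. *)
have z0 : cutoff psi (tri a b c e) = fun=> 0.
  apply/funext => k; rewrite /cutoff; have [rk|kr] := leqP r k.
    by rewrite /psi (eqP (rk : (r - k == 0)%N)) mul0r mul0r.
  by rewrite Te// mulr0.
have rr : 0 < r%:R :> R by rewrite ltr0n.
have := le_trans (le_coord_nrm p1 j lc) (low _ lc).
have := ler_wpM2l M0 main; rewrite z0 => h1 h2.
have h3 := proj2 (lp_zero (p := p) p1).
have psij : 1 / 2 <= psi j.
  rewrite /psi ler_pdivlMr// -[leLHS](_ : r%:R - r%:R / 2 = _); last by field.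
  rewrite natrB; last by lia.
  rewrite lerB// ler_pdivlMr// -natrM ler_nat; lia.
have h4 : 1 / 2 * md (e j) <= md (cutoff psi e j).
  rewrite mdM md_real ler_wpM2r ?md_ge0// ger0_norm//.
  by have /andP[] := psi01 j.
have h5 := ler_wpM2l M0 h3; rewrite mulr0 in h5.
rewrite mulrDr in h1.
have -> : 4 * K * M * nrm p e / r%:R = 2 * (M * (2 * K / r%:R * nrm p e)) by ring.
lra.
Qed.

End Stability.

(** * Cut-off sequences and applicability of the method *)

Section FiniteSectionMethod.
Context {R : realType} {p : \bar R} (p1 : (1%:E <= p)%E).
Implicit Types (A : int -> int -> R[i]) (x y : nat -> R[i]).

Lemma natr_inv_complex n : (n%:R^-1 : R[i]) = ((n%:R)^-1)%:C%C.
Proof. by rewrite fmorphV rmorph_nat. Qed.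

Lemma good_cutoffs_exist (U V W : set (R[i])^o) A (u v w : R[i]) :
  right_pseudoergodic U V W A -> U u -> V v -> W w ->
  exists r, good_cutoffs A u v w r.
Proof.
move=> pe Uu Vv Ww.
pose close n (i : int) :=
  `|A i (i - 1) - u| + `|A i i - v| + `|A i (i + 1) - w| < n%:R^-1.
have next n m : exists r : nat, [/\ (n < r)%N, (m <= r)%N &
    forall i : int, (1 <= n)%N -> r%:Z - n%:Z <= i <= r%:Z -> close n i].
  (* A third of 1 / (n + 1) for each difference. The cut-off is the end of a run of n + m + 1 rows,
     so it exceeds n and m, and {r - n, ..., r} stays in the run. *)
  have e0 : 0 < (3 * n.+1%:R)^-1 :> R by rewrite invr_gt0 mulr_gt0.
  have [k kP] := pseudoergodic_run (n + m).+1 pe Uu Vv Ww e0.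
  exists (k + (n + m).+1)%N; split; [lia|lia|].
  move=> [] i n1 ilt; last by exfalso; lia.
  have [h1 h2 h3] := kP i ltac:(lia).
  rewrite /close natr_inv_complex !normE -!rmorphD ltcR.
  apply: lt_le_trans (_ : n.+1%:R^-1 <= _).
    have -> : n.+1%:R^-1 = (3 * n.+1%:R)^-1 + (3 * n.+1%:R)^-1 + (3 * n.+1%:R)^-1 :> R.
      by field; rewrite nat1r pnatr_eq0.
    by rewrite !ltrD.
  by rewrite lef_pV2 ?posrE ?ltr0n// ler_nat.
pose g n m := proj1_sig (cid (next n m)).
have gP n m : [/\ (n < g n m)%N, (m <= g n m)%N &
    forall i : int, (1 <= n)%N -> (g n m)%:Z - n%:Z <= i <= (g n m)%:Z -> close n i].
  exact: proj2_sig (cid (next n m)).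
pose r := fix r n := if n is n'.+1 then g n (r n') else g 0%N 0%N.
have rE n : exists m, r n = g n m by case: n => [|n]; eexists.
have rn n : (n < r n)%N by have [m ->] := rE n; have [] := gP n m.
exists r; split.
- by move=> n n1; exact: leq_ltn_trans (rn n).
- move=> m n _ /subnK <-; elim: (n - m)%N => // d ih.
  by apply: leq_trans ih _; rewrite addSn /=; have [] := gP (d + m).+1 (r (d + m)%N).
- apply/cvgnyPge => N; exists N => // n /= Nn; exact: leq_trans Nn (ltnW (rn n)).
- by move=> n i n1 ilt; have [m rnE] := rE n; have [_ _] := gP n m; rewrite -rnE; exact.
Qed.

(** Once k > n and 1 / k <= eps, the window {r_k - k, ..., r_k} contains the last n + 1 positions;
    position r_k is index r_k - 1. *)
Lemma good_cutoffs_window A u v w r n (eps : R) : good_cutoffs A u v w r ->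
  0 < eps -> exists N : nat, forall k, (N <= k)%N -> (n.+1 < r k)%N /\
    window (subdiag A) (maindiag A) (superdiag A) u v w eps (r k - n.+1) n.+1.
Proof.
move=> [r0 _ /cvgnyPge/(_ n.+2)[N1 _ N1P] rw] e0.
pose N2 := (Num.truncn eps^-1).+1.
have N2e : eps^-1 < N2%:R by exact: truncnS_gt.
exists (maxn N1 (maxn N2 n.+1)) => k; rewrite !geq_max => /and3P[k1 k2 k3].
have rk := N1P k k1; rewrite /= in rk; split=> // j jlt.
have := rw k j.+1%:Z ltac:(lia) ltac:(lia).
rewrite natr_inv_complex !normE -!(rmorphD (real_complex R)) ltcR.
rewrite (_ : j.+1%:Z - 1 = j%:Z); last by lia.
rewrite (_ : j.+1%:Z + 1 = j.+2%:Z); last by lia.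
rewrite -/(subdiag A j) -/(maindiag A j) -/(superdiag A j) => h.
have ke : k%:R^-1 <= eps.
  rewrite -[leRHS]invrK lef_pV2 ?posrE ?invr_gt0 ?ltr0n//; last by lia.
  by apply: ltW; apply: lt_le_trans N2e _; rewrite ler_nat.
have := md_ge0 (subdiag A j - u); have := md_ge0 (maindiag A j - v).
have := md_ge0 (superdiag A j - w).
by split; lra.
Qed.

Lemma fsm_good_cutoffs (U V W : set (R[i])^o) A (u v w : R[i]) r :
  compact U -> compact V -> compact W -> tridiag U V W A ->
  right_pseudoergodic U V W A -> invertible_on p (mulmv (semi A)) ->
  U u -> V v -> W w -> good_cutoffs A u v w r -> fsm_applicable p (semi A) r.
Proof.
move=> cU cV cW AM pe Ainv Uu Vv Ww rgood b lb.
have [al [be [ga [de [fact ba dg]]]]] := good_factors p1 cU cV cW AM pe Ainv Uu Vv Ww.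
have [K [aK bK cK]] := tridiag_bounded cU cV cW AM.
have K0 : 0 <= K by exact: le_trans (md_ge0 _) (aK 0%N).
have [S [M [M0 SP]]] := invertible_bound Ainv.
have mE x := mulmv_tridiag x AM.
set T := tri (subdiag A) (maindiag A) (superdiag A) in mE.
have low : bounded_below (p := p) M (subdiag A) (maindiag A) (superdiag A).
  move=> x lx; have [lT _] := lp_tri p1 aK bK cK lx.
  by have [_ + _ _] := SP _ lT; rewrite -/T -mE; have [_ _ _ ->] := SP _ lx.
have [n [eps [C [eps0 C0 stab]]]] := section_stable p1 aK bK cK M0 low fact ba dg.
have [N NP] := good_cutoffs_window n rgood eps0.
have {}stab k : (N <= k)%N -> forall x, (forall j, (r k <= j)%N -> x j = 0) ->
    nrm p x <= C * nrm p (truncate (r k) (T x)).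
  by move=> /NP[rk win]; exact: stab.
have [lS nS TS _] := SP b lb.
have trunc_id q x : (forall j, (q <= j)%N -> x j = 0) -> truncate q x = x.
  by move=> x0; apply/funext => j; rewrite /truncate; case: ltnP => // /x0.
(* Stability makes the sections injective, hence uniquely solvable. *)
have inj k : (N <= k)%N -> forall x, (forall j, (r k <= j)%N -> x j = 0) ->
    (forall j, (j < r k)%N -> T x j = 0) -> forall j, x j = 0.
  move=> Nk x x0 Tx0 j; have [lx _] := lp_finite p1 x0.
  have := stab k Nk x x0; rewrite (_ : truncate _ _ = fun=> 0); last first.
    by apply/funext => i; rewrite /truncate; case: ifP => // /Tx0.
  move=> h; have := ler_wpM2l C0 (proj2 (lp_zero (p := p) p1)); rewrite mulr0.
  move=> /(le_trans h)/(le_trans (le_coord_nrm p1 j lx)) xj.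
  by apply/eqP; rewrite -md_eq0 eq_le xj md_ge0.
have sol k : exists x, (N <= k)%N -> (forall j, (r k <= j)%N -> x j = 0) /\
    (forall j, (j < r k)%N -> T x j = b j).
  (* Below N the value [b] is a mere filler. *)
  have [Nk|_] := leqP N k; last by exists b.
  have [x xP] := tri_section_solvable b (inj k Nk); by exists x.
have [xs xsP] := choice sol.
have {sol}lxs k : (N <= k)%N -> lp p (xs k) /\ nrm p (xs k) <= C * nrm p b.
  move=> Nk; have [x0 xb] := xsP k Nk; have [lx _] := lp_finite p1 x0; split=> //.
  apply: le_trans (stab k Nk _ x0) _; rewrite ler_wpM2l//.
  apply: (proj2 (lp_le p1 _ lb)) => j; rewrite /truncate.
  by case: ifP => [/xb->|_]//; rewrite md0 md_ge0.
exists (S b).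
  split=> [|y [ly yb]]; first by split.
  by have [_ _ _ <-] := SP y ly; rewrite yb.
exists N, xs; split.
- move=> k Nk; have [x0 xb] := xsP k Nk; have [lx _] := lxs k Nk; split.
    split; first by exists (xs k) => //; exact: trunc_id.
    rewrite (trunc_id _ (xs k))// mE; apply/funext => j; rewrite /truncate.
    by case: ifP => // /xb.
  move=> _ [[y ly <-]]; set x := truncate _ y.
  have x'0 j : (r k <= j)%N -> x j = 0.
    by move=> kj; rewrite /x /truncate ltnNge kj.
  rewrite (trunc_id _ x)// mE => xb'.
  have d0 j : xs k j - x j = 0.
    apply: (inj k Nk (fun j => xs k j - x j)) => {}j jr.
      by rewrite x0// x'0// subrr.
    have := congr1 (@^~ j) xb'; rewrite /truncate jr -(xb j jr) => Tj.
    transitivity (T (xs k) j - T x j); last by rewrite Tj subrr.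
    by rewrite /T /tri; case: j {jr Tj} => [|j] /=; ring.
  by apply/funext => j; apply/eqP; rewrite -subr_eq0 d0.
- exists (C * nrm p b) => k Nk; have [lx nx] := lxs k Nk.
  by rewrite nrmE// lee_fin.
move=> j.
(* [E] bounds the norm of the error uniformly in k. The first r_k rows of T annihilate the error, so
   each fixed coordinate of it is O(1 / r_k). *)
pose E := nrm p (S b) + C * nrm p b.
have est k : (N <= k)%N -> (2 * j <= r k)%N -> (0 < r k)%N ->
    md (S b j - xs k j) <= 4 * K * M * E / (r k)%:R.
  move=> Nk jr rk; have [lx nx] := lxs k Nk; have [x0 xb] := xsP k Nk.
  pose e i := S b i - xs k i.
  have [le0 ne0] := lp_scale p1 (-1) lx; rewrite mdN md1 mul1r in ne0.
  have [le1 ne1] : lp p e /\ nrm p e <= E.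
    have [le1 ne1] := lp_add p1 lS le0.
    have -> : e = fun i => S b i + -1 * xs k i by apply/funext => i; rewrite mulN1r.
    split=> //; apply: le_trans ne1 _; rewrite lerD//.
    exact: le_trans ne0 nx.
  have Te i : (i < r k)%N -> T e i = 0.
    move=> ir; transitivity (T (S b) i - T (xs k) i).
      by rewrite /T /tri /e; case: i {ir} => [|i] /=; ring.
    by rewrite xb// -mE TS subrr.
  apply: le_trans (section_error p1 aK bK cK M0 low le1 Te rk jr) _.
  by rewrite ler_wpM2r// ler_wpM2l// !mulr_ge0.
apply/cvgrPdist_lt => eC eC0.
have [e eE e0] : exists2 e : R, eC = e%:C%C & 0 < e.
  exists (complex.Re eC); move: eC0; rewrite ltcE /= => /andP[/eqP ei] //.
  by case: eC ei => ? ? /= ->.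
pose L := (Num.truncn (4 * K * M * E / e)).+1.
have LP : 4 * K * M * E / e < L%:R by exact: truncnS_gt.
have [_ _ /cvgnyPge/(_ (maxn L (2 * j)))[N1 _ N1P] _] := rgood.
exists (maxn N N1) => // k /=; rewrite geq_max => /andP[Nk N1k].
have := N1P k N1k; rewrite /= geq_max => /andP[Lr jr].
have rk : (0 < r k)%N by exact: leq_trans Lr.
rewrite normE eE ltcR; apply: le_lt_trans (est k Nk jr rk) _.
rewrite ltr_pdivrMr ?ltr0n// [ltRHS]mulrC -ltr_pdivrMr//.
by apply: lt_le_trans LP _; rewrite ler_nat.
Qed.

End FiniteSectionMethod.

Theorem mainTheorem4 (R : realType) (U V W : set (R[i])^o) (p : \bar R)
    (A : int -> int -> R[i]) (u v w : R[i])
    (U0 : U !=set0) (V0 : V !=set0) (W0 : W !=set0)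
    (cU : compact U) (cV : compact V) (cW : compact W)
    (p1 : (1%:E <= p)%E)
    (AM : tridiag U V W A) (Ape : right_pseudoergodic U V W A)
    (Ainv : invertible_on p (mulmv (semi A)))
    (Uu : U u) (Vv : V v) (Ww : W w) :
  [/\ exists r : nat -> nat, good_cutoffs A u v w r,
      V `<=` ellipses_ext U W &
      forall r : nat -> nat, good_cutoffs A u v w r ->
        fsm_applicable p (semi A) r].
Proof.
split.
- exact: good_cutoffs_exist Ape Uu Vv Ww.
- move=> v' Vv' u' Uu' w' Ww'.
  (* Pseudoergodicity provides windows for every triple of U x V x W, so the zeros are located for
     all of them. *)
  have [al [be [ga [de [fact ba dg]]]]] :=
    good_factors p1 cU cV cW AM Ape Ainv Uu' Vv' Ww'.
  exact: factors_ellipse_ext fact ba dg.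
- move=> r rgood.
  exact: (fsm_good_cutoffs p1 cU cV cW AM Ape Ainv Uu Vv Ww rgood).
Qed.
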